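(* Let $\mathbb{P}$ be a $\sigma$-finite stationary measure on $(\Omega,\mathcal{F})$. Let $\xi$ and $\eta$ be invariant random measures on $G$ with positive and finite intensities. Then there exists a $\mathbb{P}$-a.e. $(\xi,\eta)$-balancing invariant transport-kernel if and only if $$\mathbb{E}_{\mathbb{P}}[\xi(B)\mid\mathcal{I}]=\mathbb{E}_{\mathbb{P}}[\eta(B)\mid\mathcal{I}]\qquad\mathbb{P}\text{-a.e.}$$ for some $B\in\mathcal{G}$ satisfying $0<\lambda(B)<\infty$.
   Context: $G$ is a locally compact, second countable Hausdorff topological Abelian group with neutral element $0$, Borel $\sigma$-field $\mathcal{G}$ and fixed Haar measure $\lambda$. $\mathbf{M}$ is the set of locally finite measures on $G$ (finite on compact sets), with the $\sigma$-field generated by the maps $\mu\mapsto\mu(B)$, $B\in\mathcal{G}$. $(\Omega,\mathcal{F})$ is a measurable space equipped with a measurable flow $\theta_s:\Omega\to\Omega$, $s\in G$: $(\omega,s)\mapsto\theta_s\omega$ is measurable, $\theta_0$ is the identity, and $\theta_s\circ\theta_t=\theta_{s+t}$ for all $s,t\in G$. A measure $\mathbb{P}$ on $(\Omega,\mathcal{F})$ is stationary if it is invariant under every $\theta_s$, $s\in G$. The invariant $\sigma$-field $\mathcal{I}\subset\mathcal{F}$ is the class of all $A\in\mathcal{F}$ with $\theta_sA=A$ for all $s\in G$, where $\theta_sA:=\{\theta_s\omega:\omega\in A\}$. Conditional expectations with respect to the $\sigma$-finite measure $\mathbb{P}$ are defined as for probability measures: $\mathbb{E}_{\mathbb{P}}[X\mid\mathcal{I}]$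 is an $\mathcal{I}$-measurable function $Y\ge 0$ with $\mathbb{E}_{\mathbb{P}}[\mathbf{1}_AY]=\mathbb{E}_{\mathbb{P}}[\mathbf{1}_AX]$ for all $A\in\mathcal{I}$ (for $X\ge 0$), where $\mathbb{E}_{\mathbb{P}}$ denotes integration with respect to $\mathbb{P}$. A random measure on $G$ is a measurable map $\xi:\Omega\to\mathbf{M}$, written $\xi(\omega,B):=\xi(\omega)(B)$; it is invariant if $\xi(\theta_s\omega,B-s)=\xi(\omega,B)$ for all $\omega\in\Omega$, $s\in G$, $B\in\mathcal{G}$. The intensity of an invariant random measure $\xi$ is $\mathbb{P}_\xi(\Omega)$, where the Palm measure $\mathbb{P}_\xi$ is $$\mathbb{P}_\xi(A):=\lambda(B)^{-1}\iint \mathbf{1}_A(\theta_s\omega)\mathbf{1}_B(s)\,\xi(\omega,ds)\,\mathbb{P}(d\omega),\qquad A\in\mathcal{F},$$ for any $B\in\mathcal{G}$ with $0<\lambda(B)<\infty$ (the definition does not depend on $B$); thus the intensity equals $\lambda(B)^{-1}\mathbb{E}_{\mathbb{P}}[\xi(B)]$. A transport-kernel is a Markovian kernel $T$ from $\Omega\times G$ to $G$ (i.e. $T(\omega,s,\cdot)$ is a probability measure for all $(\omega,s)$). It is invariant if $T(\theta_t\omega,s-t,B-t)=T(\omega,s,B)$ for all $s,t\in G$, $\omega\in\Omega$, $B\in\mathcal{G}$, and $\mathbb{P}$-a.e. $(\xi,\eta)$-balancing if $\int T(\omega,s,\cdot)\,\xi(\omega,ds)=\eta(\omega,\cdot)$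 for $\mathbb{P}$-a.e. $\omega\in\Omega$.
   Formalization: The formal theorem additionally assumes that the conditional expectations of ξ(B) and η(B) given the invariant σ-field exist for all B with 0<λ(B)<∞; this can fail when P is not σ-finite on that σ-field (e.g. Lebesgue measure on ℝ under translations, ξ(ω,·)=δ_{−ω}). *)

(* Defs.v *)
From HB Require Import structures.
From mathcomp Require Import all_boot all_order all_algebra.
From mathcomp Require Import all_classical all_reals all_analysis.
From mathcomp Require Import measurable_realfun.

Set Implicit Arguments.
Unset Strict Implicit.
Unset Printing Implicit Defensive.
Import Order.TTheory GRing.Theory Num.Theory.
Local Open Scope classical_set_scope.
Local Open Scope ring_scope.
Local Open Scope ereal_scope.

(* A topological Abelian group with its Borel sigma-field.  The alias is needed
   because measurable types are pointed, while topological groups are not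
   declared to be (the point is chosen to be 0). *)
Definition borel (G : topologicalZmodType) : Type := G.

HB.instance Definition _ (G : topologicalZmodType) :=
  TopologicalZmodule.on (borel G).
HB.instance Definition _ (G : topologicalZmodType) :=
  isPointed.Build (borel G) 0%R.
HB.instance Definition _ (G : topologicalZmodType) :=
  Measurable.copy (borel G) (g_sigma_algebraType (@open (borel G))).

(* B - s *)
Definition shift (G : topologicalZmodType) (B : set (borel G)) (s : borel G) :
  set (borel G) := [set (b - s)%R | b in B].

Definition locally_finite (R : realType) (G : topologicalZmodType)
    (mu : {measure set (borel G) -> \bar R}) : Prop :=
  forall K : set (borel G), compact K -> mu K < +oo.

(* Regularity is automatic on a locally compact second countable group. *)
Record haar_measure (R : realType) (G : topologicalZmodType)
    (lambda : {measure set (borel G) -> \bar R}) : Prop := {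
  haar_locally_finite : locally_finite lambda ;
  haar_neq0 : lambda [set: borel G] != 0 ;
  haar_invariant : forall (B : set (borel G)) (s : borel G), measurable B ->
    lambda (shift B s) = lambda B
}.

Record lfmeasure (R : realType) (G : topologicalZmodType) := LFMeasure {
  lfmeasure_val :> {measure set (borel G) -> \bar R} ;
  lfmeasureP : locally_finite lfmeasure_val
}.

Section lfmeasure_sigma_field.
Variables (R : realType) (G : topologicalZmodType).

HB.instance Definition _ := gen_eqMixin (lfmeasure R G).
HB.instance Definition _ := gen_choiceMixin (lfmeasure R G).

Let mzero_locally_finite :
  locally_finite (mzero : {measure set (borel G) -> \bar R}).
Proof. by move=> K _; exact: ltry. Qed.

HB.instance Definition _ :=
  isPointed.Build (lfmeasure R G) (LFMeasure mzero_locally_finite).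

Definition lfmeasure_evals : set (set (lfmeasure R G)) :=
  [set [set mu : lfmeasure R G | V (mu B)] |
    B in (measurable : set (set (borel G))) &
    V in (measurable : set (set (\bar R)))].

HB.instance Definition _ :=
  Measurable.copy (lfmeasure R G) (g_sigma_algebraType lfmeasure_evals).

End lfmeasure_sigma_field.

Section stationary.
Context (d : measure_display) (Omega : measurableType d) (R : realType).
Context (G : topologicalZmodType).
Implicit Types (P : {measure set Omega -> \bar R}).
Implicit Types (theta : borel G -> Omega -> Omega).

Record measurable_flow theta : Prop := {
  flow_measurable :
    measurable_fun [set: Omega * borel G]
      (fun p : Omega * borel G => theta p.2 p.1) ;
  flow0 : forall w : Omega, theta 0%R w = w ;
  flowD : forall (s t : borel G) (w : Omega),
    theta s (theta t w) = theta (s + t)%R w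
}.

Definition stationary theta P : Prop :=
  forall (s : borel G) (A : set Omega), measurable A ->
    P (theta s @^-1` A) = P A.

Definition invariant_sigma_field theta : set (set Omega) :=
  [set A | measurable A /\ forall s : borel G, theta s @` A = A].

Definition random_measure := {mfun Omega >-> lfmeasure R G}.

Definition invariant_random_measure theta (xi : random_measure) : Prop :=
  forall (w : Omega) (s : borel G) (B : set (borel G)), measurable B ->
    xi (theta s w) (shift B s) = xi w B.

(* The Palm measure of xi, computed with the reference set B. *)
Definition palm (lambda : {measure set (borel G) -> \bar R}) theta P
    (xi : random_measure) (B : set (borel G)) (A : set Omega) : \bar R :=
  ((fine (lambda B))^-1)%:E *
  \int[P]_w \int[xi w]_s ((\1_A (theta s w))%:E * (\1_B s)%:E).

(* For an invariant xi the value palm lambda theta P xi B [set: Omega] does not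
   depend on B; it is the intensity of xi. *)
Definition positive_finite_intensity
    (lambda : {measure set (borel G) -> \bar R}) theta P
    (xi : random_measure) : Prop :=
  forall B : set (borel G), measurable B -> 0 < lambda B < +oo ->
    0 < palm lambda theta P xi B [set: Omega] < +oo.

Definition invariant_kernel theta
    (T : R.-pker (Omega * borel G) ~> borel G) : Prop :=
  forall (s t : borel G) (w : Omega) (B : set (borel G)), measurable B ->
    T (theta t w, (s - t)%R) (shift B t) = T (w, s) B.

Definition ae_balancing P (xi eta : random_measure)
    (T : R.-pker (Omega * borel G) ~> borel G) : Prop :=
  {ae P, forall w, forall B : set (borel G), measurable B ->
    \int[xi w]_s T (w, s) B = eta w B}.

(* Y is a version of E_P[X | I], for a sub-sigma-field I and X >= 0. *)
Record is_condexp P (I : set (set Omega)) (X Y : Omega -> \bar R) : Prop := {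
  condexp_ge0 : forall w, 0 <= Y w ;
  condexp_measurable : forall V : set (\bar R), measurable V -> I (Y @^-1` V) ;
  condexp_integral : forall A : set Omega, I A ->
    \int[P]_w ((\1_A w)%:E * Y w) = \int[P]_w ((\1_A w)%:E * X w)
}.

(* Not automatic: P is sigma-finite on Omega, but its restriction to I need not
   be, and then there may be no version at all. *)
Definition has_condexp P (I : set (set Omega)) (X : Omega -> \bar R) : Prop :=
  exists Y : Omega -> \bar R, is_condexp P I X Y.

(* E_P[X | I] = E_P[X' | I] holds P-a.e. *)
Definition ae_eq_condexp P (I : set (set Omega)) (X X' : Omega -> \bar R) :
    Prop :=
  exists Y Y' : Omega -> \bar R, [/\ is_condexp P I X Y,
    is_condexp P I X' Y' & {ae P, forall w, Y w = Y' w}].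

End stationary.
Arguments random_measure {d} Omega R G.

(* Main.v *)
Require Import Defs.
From HB Require Import structures.
From mathcomp Require Import all_boot all_order all_algebra.
From mathcomp Require Import all_classical all_reals all_analysis.
From mathcomp Require Import measurable_realfun.
(** Necessity is the mass-transport principle: by stationarity and Tonelli, an
    expected mass sent by an invariant kernel into a window B, restricted to an
    invariant event J, equals the expected mass that the kernel sends out of B
    ([mass_transport], [balancing_invariant_integral]).  As T is Markovian the
    latter is the xi-mass of B, and as T balances the former is the eta-mass.
    The two conditional expectations then have the same integral, which is
    finite, on every invariant event, hence they agree ([condexp_unique]).

    For sufficiency the kernel is built by an explicit greedy matching.  Fix a
    strictly positive probability density p on G.  Spread every point t of xi
    over G with density s |-> p (s - t), and do the same with eta.  At a place s
    the spread masses have densities X (theta_s w) and Y (theta_s w), where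
    X = [smooth] xi 1 and Y = [smooth] eta 1.  Match min(X, Y) of them there,
    proportionally on both sides: mass of xi that travelled from t to s is sent
    on to a point u of eta with weight p (s - u).  Points keep the fraction of
    their mass that was not matched ([residue]), and the step is repeated with
    the remainders.  Each round removes the same mass from both sides of every
    invariant event ([integral_matched], [exchange_sym]), so the sum over all
    rounds of the expected matched densities is at most the intensity; hence
    the round masses tend to 0, and in the limit the leftovers X' and Y'
    satisfy min(X', Y') = 0 almost surely ([unmatched_disjoint]).

    If both sides start with the same mass on every invariant event, the same
    is true of the leftovers ([unmatched_balance]).  Since p never vanishes,
    X' (theta_s w) > 0 for one s if and only if it holds for all s, so
    J = {X' > 0} is itself an invariant event.  On J the leftover Y' vanishes,
    hence the integral of X' over J is that of Y', which is 0: nothing is left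
    over ([unmatched_negligible]).

    The resulting kernel has an explicit density with respect to eta
    ([transport_density]), to which a point mass at t is added for the fraction
    of t that is never matched.  It is a probability kernel and it is invariant
    for every w; only the balancing property needs an exceptional set, namely
    the set where something is left over ([balancing_kernel_of_density]). *)

Set Implicit Arguments.
Unset Strict Implicit.
Unset Printing Implicit Defensive.
Import Order.TTheory GRing.Theory Num.Theory.
Local Open Scope classical_set_scope.
Local Open Scope ring_scope.
Local Open Scope ereal_scope.

(** * Borel structure of a second countable group *)
Section borel_group.
Context (G : topologicalZmodType).
Context (G_second_countable : @second_countable G).

Lemma open_borel (U : set (borel G)) : open U -> measurable U.
Proof. exact: sub_sigma_algebra. Qed.

Lemma closed_borel (K : set (borel G)) : closed K -> measurable K.
Proof.
move=> cK; rewrite -[K]setCK; apply: measurableC.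
by apply: open_borel; exact: closed_openC.
Qed.

Lemma continuous_borel (f : borel G -> borel G) :
  continuous f -> measurable_fun setT f.
Proof.
move=> /continuousP cf; apply: (@measurability _ _ _ _ _ _ (@open (borel G))) => //.
by move=> _ [U oU <-]; rewrite setTI; apply: open_borel; exact: cf.
Qed.

Lemma measurable_oppG : measurable_fun setT (fun x : borel G => - x : borel G)%R.
Proof. by apply: continuous_borel => x; exact: opp_continuous. Qed.

Lemma countable_bigcup_measurable d (T : measurableType d) I (D : set I)
    (F : I -> set T) :
  countable D -> (forall i, D i -> measurable (F i)) ->
  measurable (\bigcup_(i in D) F i).
Proof.
move=> cD mF; rewrite bigcup_set_type.
apply: countable_bigcupT_measurable; last by move=> i; apply: mF; exact: set_valP.
by rewrite (eq_countable (card_setT D)).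
Qed.

(** Second countability makes the Borel sigma-field of G x G the product one:
    an open set of pairs is a countable union of products of basic open sets. *)
Lemma measurable_addG :
  measurable_fun setT (fun x : borel G * borel G => x.1 + x.2 : borel G)%R.
Proof.
apply: (@measurability _ _ _ _ _ _ (@open (borel G))) => // _ [U oU <-].
rewrite setTI; set V := _ @^-1` U.
have [B cB [oB nB]] := G_second_countable.
pose D := [set p : set G * set G | [/\ B p.1, B p.2 & p.1 `*` p.2 `<=` V]].
have -> : V = \bigcup_(p in D) (p.1 `*` p.2).
  apply/seteqP; split=> [[x y] /= Vxy|]; last by move=> x [p [_ _]] /[apply].
  have : nbhs ((x, y) : G * G) V.
    apply: open_nbhs_nbhs; split => //.
    by move/continuousP: (@add_continuous G); apply.
  move=> [[Q1 Q2] [/= Q1x Q2y] QV].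
  have [W1 [BW1 W1x] W1Q] := nB x Q1 Q1x.
  have [W2 [BW2 W2y] W2Q] := nB y Q2 Q2y.
  exists (W1, W2) => //; split => //= -[a b] [/= /W1Q aQ /W2Q bQ].
  exact: QV.
apply: countable_bigcup_measurable.
  have DB : D `<=` B `*` B by move=> p [].
  exact: sub_countable (subset_card_le DB) (countableX cB _).
by move=> p [B1 B2 _]; apply: measurableX; apply: open_borel; exact: oB.
Qed.

Lemma measurable_addGf d (T : measurableType d) (f g : T -> borel G) :
  measurable_fun setT f -> measurable_fun setT g ->
  measurable_fun setT (fun x => f x + g x : borel G)%R.
Proof.
move=> mf mg; apply: (measurableT_comp measurable_addG (g := fun x => (f x, g x))).
exact: measurable_fun_pair.
Qed.

Lemma measurable_oppGf d (T : measurableType d) (f : T -> borel G) :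
  measurable_fun setT f -> measurable_fun setT (fun x => - f x : borel G)%R.
Proof. exact: measurableT_comp measurable_oppG. Qed.

Lemma measurable_subGf d (T : measurableType d) (f g : T -> borel G) :
  measurable_fun setT f -> measurable_fun setT g ->
  measurable_fun setT (fun x => f x - g x : borel G)%R.
Proof. by move=> mf mg; apply: measurable_addGf => //; exact: measurable_oppGf. Qed.

Lemma shiftE (B : set (borel G)) (s : borel G) :
  Defs.shift B s = (fun x => x + s : borel G)%R @^-1` B.
Proof.
apply/seteqP; split=> [_ [b Bb <-]|x /= Bx]; first by rewrite /= subrK.
by exists (x + s)%R => //; rewrite addrK.
Qed.

Lemma measurable_shift (B : set (borel G)) (s : borel G) :
  measurable B -> measurable (Defs.shift B s).
Proof.
move=> mB; rewrite shiftE -[X in measurable X]setTI.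
by apply: measurable_addGf => //; exact: measurable_cst.
Qed.

End borel_group.

Section exhaustion.
Context (R : realType) (G : topologicalZmodType).
Context (G_locally_compact : locally_compact [set: G]).
Context (G_second_countable : @second_countable G).

(** The sets exhaust G uniformly in the locally finite measure: this is what
    makes kernels of locally finite measures measurable in their parameter.
    They are finite unions of basic open sets with compact closure. *)
Lemma borel_exhaustion : exists D : nat -> set (borel G),
  [/\ forall n, measurable (D n), nondecreasing_seq D, \bigcup_n D n = setT &
   forall (mu : {measure set (borel G) -> \bar R}) n,
     locally_finite mu -> mu (D n) < +oo].
Proof.
have [B cB [oB nB]] := G_second_countable.
pose C := [set U : set G | B U /\ precompact U].
have cC : countable C by apply: sub_countable cB; apply: subset_card_le => U [].
have /countable_injP[f injf] := cC.
pose F n := \bigcup_(U in C `&` [set U | f U = n]) U.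
have FE n : F n = set0 \/ exists2 U, C U & F n = U.
  have [[U [CU fU]]|h] := pselect (exists U, C U /\ f U = n); last first.
    left; apply/seteqP; split => // x [U [CU fU] _].
    by exfalso; apply: h; exists U.
  right; exists U => //; apply/seteqP; split; last by move=> x Ux; exists U.
  move=> x [V [CV fV] Vx]; suff -> : U = V by [].
  by apply: injf; rewrite ?inE//; rewrite fU fV.
have mF n : measurable (F n : set (borel G)).
  have [->|[U [BU _] ->]] := FE n; first exact: measurable0.
  apply: open_borel; exact: oB.
exists (fun n => \big[setU/set0]_(i < n.+1) F i); split.
- by move=> n; exact: bigsetU_measurable.
- by move=> i j ij; exact/subsetPset/subset_bigsetU.
- apply/seteqP; split => // x _.
  have [K wK [cK clK]] := @G_locally_compact x I.
  have nK : nbhs x K by apply: (@filterS _ (nbhs x) _ _ _ _ wK) => y; exact.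
  have [U [BU Ux] UK] := nB x K nK.
  exists (f U) => //; apply: (bigsetU_sup (F := F) (ltnSn (f U))).
  by exists U => //; split => //; split => //; exists K.
- move=> mu n lf; rewrite (le_lt_trans (Boole_inequality _ _))//.
  apply/lte_sum_pinfty => j _.
  have [->|[U [BU [K UK [cK clK]]] ->]] := FE j; first by rewrite measure0.
  apply: (@le_lt_trans _ _ (mu K)); last exact: lf.
  apply: le_measure => //; rewrite inE; first by apply: open_borel; exact: oB.
  exact: closed_borel.
Qed.

Lemma locally_finite_sigma_finite (mu : {measure set (borel G) -> \bar R}) :
  locally_finite mu -> sigma_finite setT mu.
Proof.
move=> lf; have [D [mD _ UD fD]] := borel_exhaustion.
by exists D => // n; split => //; exact: fD.
Qed.

End exhaustion.

(** * Integration against kernels of infinite total mass *)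
Section integral_kernel.
Context (R : realType).

(** The masses k x (D n) are finite but not bounded in x, so k need not come
    with a decomposition into uniformly bounded kernels.  On each D n the
    monotone class argument needs finiteness only pointwise in x, and the
    general case follows by monotone limit. *)
Lemma measurable_xsection_exhausted_kernel d1 d2 (X : measurableType d1)
    (Y : measurableType d2) (k : X -> {measure set Y -> \bar R})
    (D : nat -> set Y) :
  (forall U, measurable U -> measurable_fun setT (k ^~ U)) ->
  (forall n, measurable (D n)) -> nondecreasing_seq D -> \bigcup_n D n = setT ->
  (forall x n, k x (D n) < +oo) ->
  forall A, measurable A -> measurable_fun setT (fun x => k x (xsection A x)).
Proof.
move=> mk mD ndD UD fD A mA.
pose kk : R.-ker X ~> Y := HB.pack k (isKernel.Build _ _ X Y R k mk).
have mkn n : measurable_fun setT (fun x => k x (xsection A x `&` D n)).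
  have fk x : exists M : R, forall V, measurable V -> mrestr (kk x) (mD n) V < M%:E.
    exists (fine (k x (D n)) + 1)%R => V mV.
    apply: (@le_lt_trans _ _ (k x (D n))).
      by rewrite /mrestr; apply: le_measure; rewrite ?inE//; exact: measurableI.
    by rewrite -[ltLHS]fineK ?ge0_fin_numE// lte_fin ltrDl.
  by have [] := measurable_prod_subset_xsection_kernel fk mA.
apply: (emeasurable_fun_cvg (fun n x => k x (xsection A x `&` D n))) => // x _.
have mxA := measurable_xsection x mA.
have -> : k x (xsection A x) = k x (\bigcup_n (xsection A x `&` D n)).
  by rewrite -setI_bigcupr UD setIT.
apply: nondecreasing_cvg_mu => [n||]; [exact: measurableI| |].
  by apply: bigcup_measurable => n _; exact: measurableI.
by move=> m n mn; have /subsetPset h := ndD m n mn; apply/subsetPset; exact: setIS.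
Qed.

Import HBNNSimple.

Lemma measurable_integral_exhausted_kernel d1 d2 (X : measurableType d1)
    (Y : measurableType d2) (k : X -> {measure set Y -> \bar R})
    (D : nat -> set Y) (f : X * Y -> \bar R) :
  (forall U, measurable U -> measurable_fun setT (k ^~ U)) ->
  (forall n, measurable (D n)) -> nondecreasing_seq D -> \bigcup_n D n = setT ->
  (forall x n, k x (D n) < +oo) ->
  measurable_fun setT f -> (forall z, 0 <= f z) ->
  measurable_fun setT (fun x => \int[k x]_y f (x, y)).
Proof.
move=> mk mD ndD UD fD mf f0.
pose f_ := nnsfun_approx measurableT mf.
apply: (@measurable_fun_xsection_integral _ _ _ _ _ f k f_).
- by move=> a b ab; exact/nd_nnsfun_approx.
- by move=> z; exact/cvg_nnsfun_approx.
- by move=> n r; apply: (measurable_xsection_exhausted_kernel mk mD ndD UD fD).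
Qed.

Lemma sigma_finite_tonelli d1 d2 (X : measurableType d1) (Y : measurableType d2)
    (m1 : {measure set X -> \bar R}) (m2 : {measure set Y -> \bar R})
    (f : X * Y -> \bar R) :
  sigma_finite setT m1 -> sigma_finite setT m2 ->
  measurable_fun setT f -> (forall z, 0 <= f z) ->
  \int[m1]_x \int[m2]_y f (x, y) = \int[m2]_y \int[m1]_x f (x, y).
Proof.
move=> s1 s2 mf f0.
pose S1 := isSigmaFinite.Build _ _ _ _ s1.
pose S1' := isSFinite.Build _ _ _ _ (sfinite_measure_sigma_finite s1).
pose S2 := isSigmaFinite.Build _ _ _ _ s2.
pose S2' := isSFinite.Build _ _ _ _ (sfinite_measure_sigma_finite s2).
pose n1 := HB.pack_for (sigma_finite_measure X R) (Measure.sort m1) S1' S1.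
pose n2 := HB.pack_for (sigma_finite_measure Y R) (Measure.sort m2) S2' S2.
exact: (@fubini_tonelli _ _ _ _ _ n1 n2 f mf f0).
Qed.

End integral_kernel.

Section measure_tools.
Context d (T : measurableType d) (R : realType) (mu : {measure set T -> \bar R}).

Lemma measurable_eindic (A : set T) : measurable A ->
  measurable_fun setT (fun x => (\1_A x)%:E : \bar R).
Proof. by move=> mA; exact/measurable_EFinP/measurable_indic. Qed.

Lemma ge0_integral_eq0_ae (f : T -> \bar R) :
  measurable_fun setT f -> (forall x, 0 <= f x) -> \int[mu]_x f x = 0 ->
  {ae mu, forall x, f x = 0}.
Proof.
move=> mf f0 If.
have /(ae_eq_integral_abs mu measurableT mf) : \int[mu]_x `|f x| = 0.
  by rewrite -[RHS]If; apply: eq_integral => x _; rewrite gee0_abs.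
by apply: filterS => x; exact.
Qed.

(** Weight the n-th piece of a sigma-finite cover by 2^-n divided by one plus
    its mass, then normalise. *)
Lemma sigma_finite_density : sigma_finite setT mu -> mu setT != 0 ->
  exists p : T -> \bar R,
    [/\ measurable_fun setT p, forall x, 0 < p x & \int[mu]_x p x = 1].
Proof.
move=> [D UD mD] muT.
pose c n : R := (1 / (2 ^ n.+1)%:R / (1 + fine (mu (D n))))%R.
have c0 n : (0 < c n)%R by rewrite !divr_gt0// ltr_wpDr// fine_ge0.
pose q x := \sum_(n <oo) (c n)%:E * (\1_(D n) x)%:E.
have t0 n x : 0 <= (c n)%:E * (\1_(D n) x)%:E :> \bar R.
  by rewrite mule_ge0// lee_fin// ltW.
have mt n : measurable_fun setT (fun x => (c n)%:E * (\1_(D n) x)%:E).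
  apply: measurable_funeM; apply/measurable_EFinP; apply: measurable_indic.
  by have [] := mD n.
have mq : measurable_fun setT q.
  by apply: ge0_emeasurable_sum => //.
have q0 x : 0 < q x.
  have [n _ Dnx] : (\bigcup_n D n) x by rewrite -UD.
  have := @nneseries_lim_ge R (fun n => (c n)%:E * (\1_(D n) x)%:E) xpredT 0%N n.+1.
  move=> /(_ (fun n _ _ => t0 n x)); apply: lt_le_trans.
  rewrite big_nat_recr//= [X in X%:E * _]/c indicE mem_set// mule1.
  apply: (@lt_le_trans _ _ (c n)%:E); first by rewrite lte_fin.
  by rewrite leeDr// sume_ge0.
have Iq : \int[mu]_x q x <= 1.
  rewrite integral_nneseries//.
  apply: le_trans (epsilon_trick0 xpredT (@ler01 R)).
  apply: lee_nneseries => [n _ _|n _]; first exact: integral_ge0.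
  have [mDn fDn] := mD n.
  rewrite ge0_integralZl_EFin//; last 2 first.
  - exact: measurable_eindic.
  - exact/ltW.
  rewrite integral_indic// setIT -[mu (D n)]fineK ?ge0_fin_numE//.
  rewrite -EFinM lee_fin /c !div1r -mulrA ler_piMr ?invr_ge0//. 
  by rewrite mulrC ler_pdivrMr ?mul1r ?lerDr// ltr_wpDr// fine_ge0.
(* A strictly positive function with zero integral forces mu = 0. *)
have Iq0 : 0 < \int[mu]_x q x.
  rewrite lt0e integral_ge0 ?andbT; last by move=> x _; exact: ltW.
  apply: contra_neq muT => /(ge0_integral_eq0_ae mq (fun x => ltW (q0 x))).
  move=> [N [mN muN subN]]; apply/eqP; rewrite -measure_le0 -muN.
  apply: le_measure; rewrite ?inE// => x _; apply: subN => /= qx.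
  by have := q0 x; rewrite qx ltxx.
have fq : \int[mu]_x q x \is a fin_num.
  by rewrite ge0_fin_numE ?(le_lt_trans Iq) ?ltry// ltW.
pose r := (fine (\int[mu]_x q x))^-1%R.
have r0 : (0 < r)%R by rewrite invr_gt0 fine_gt0// Iq0 (le_lt_trans Iq) ?ltry.
exists (fun x => r%:E * q x); split.
- exact: measurable_funeM.
- by move=> x; rewrite mule_gt0.
- rewrite ge0_integralZl_EFin//; last 2 first.
  + by move=> x _; exact: ltW.
  + exact: ltW.
  by rewrite -[X in _ * X]fineK// -EFinM mulVf// gt_eqF// -invr_gt0.
Qed.

End measure_tools.

(** * Haar integration *)
Section borel_integral.
Context (R : realType) (G : topologicalZmodType).
Context (G_locally_compact : locally_compact [set: G]).
Context (G_second_countable : @second_countable G).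

Lemma measurable_lfmeasure_eval (B : set (borel G)) : measurable B ->
  measurable_fun setT (fun mu : lfmeasure R G => mu B).
Proof.
move=> mB _ V mV; rewrite setTI; apply: sub_sigma_algebra.
by exists B => //; exists V.
Qed.

Lemma measurable_integral_lfmeasure d (X : measurableType d)
    (m : X -> lfmeasure R G) (f : X * borel G -> \bar R) :
  measurable_fun setT m -> measurable_fun setT f -> (forall z, 0 <= f z) ->
  measurable_fun setT (fun x => \int[m x]_s f (x, s)).
Proof.
move=> mm mf f0.
have [D [mD ndD UD fD]] :=
  borel_exhaustion R G_locally_compact G_second_countable.
apply: (measurable_integral_exhausted_kernel _ mD ndD UD) => //.
  by move=> U mU; exact: (measurableT_comp (measurable_lfmeasure_eval mU) mm).
by move=> x n; apply: fD; exact: lfmeasureP.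
Qed.

Lemma lfmeasure_sigma_finite (m : lfmeasure R G) : sigma_finite setT m.
Proof. by apply: locally_finite_sigma_finite => //; exact: lfmeasureP. Qed.

Lemma integral_shift (m1 m2 : {measure set (borel G) -> \bar R}) (s : borel G)
    (f : borel G -> \bar R) :
  (forall B, measurable B -> m1 (Defs.shift B s) = m2 B) ->
  measurable_fun setT f -> (forall x, 0 <= f x) ->
  \int[m1]_x f x = \int[m2]_x f (x - s)%R.
Proof.
move=> m12 mf f0.
have msub : measurable_fun setT (fun x : borel G => x - s : borel G)%R.
  by apply: measurable_subGf => //; exact: measurable_cst.
rewrite (@eq_measure_integral _ _ _ _ (pushforward m2 (fun x => x - s)%R)).
  by rewrite ge0_integral_pushforward// preimage_setT.
move=> A mA _.
have mA' : measurable ((fun x : borel G => x - s)%R @^-1` A : set (borel G)).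
  by rewrite -[X in measurable X]setTI; exact: msub.
transitivity (m1 (Defs.shift ((fun x : borel G => x - s)%R @^-1` A) s)).
  congr (m1 _); rewrite shiftE; apply/seteqP.
  by split=> x /=; rewrite addrK.
exact: m12.
Qed.

Context (lambda : {measure set (borel G) -> \bar R}).
Context (lambda_haar : haar_measure lambda).

Lemma haar_sigma_finite : sigma_finite setT lambda.
Proof.
by apply: locally_finite_sigma_finite => //; exact: haar_locally_finite.
Qed.

Lemma haar_translate (f : borel G -> \bar R) (s : borel G) :
  measurable_fun setT f -> (forall x, 0 <= f x) ->
  \int[lambda]_x f (x - s)%R = \int[lambda]_x f x.
Proof.
move=> mf f0; rewrite -(integral_shift (m1 := lambda))// => B mB.
by case: lambda_haar => _ _; exact.
Qed.

Lemma haar_translateD (f : borel G -> \bar R) (s : borel G) :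
  measurable_fun setT f -> (forall x, 0 <= f x) ->
  \int[lambda]_x f (x + s)%R = \int[lambda]_x f x.
Proof.
move=> mf f0; rewrite -[RHS](haar_translate (- s)%R)//.
by apply: eq_integral => x _; rewrite opprK.
Qed.

Lemma haar_density : exists p : borel G -> \bar R,
  [/\ measurable_fun setT p, forall x, 0 < p x & \int[lambda]_x p x = 1].
Proof.
apply: sigma_finite_density; first exact: haar_sigma_finite.
by case: lambda_haar.
Qed.

(** Inversion preserves Haar measure because G is abelian: for a probability
    density g, the integral of g(x) f(-y) over x and y becomes that of
    g(x) f(x - y) by translating y, and that of g(x + y) f(x) by translating
    x. *)
Lemma haar_opp (f : borel G -> \bar R) :
  measurable_fun setT f -> (forall x, 0 <= f x) ->
  \int[lambda]_x f (- x)%R = \int[lambda]_x f x.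
Proof.
move=> mf f0; have [g [mg g0 Ig]] := haar_density.
have {}g0 x : 0 <= g x by exact: ltW.
have mfN : measurable_fun setT (fun x : borel G => f (- x)%R).
  by apply: (measurableT_comp mf); exact: measurable_oppG.
transitivity (\int[lambda]_x \int[lambda]_y (g x * f (x - y)%R)).
  rewrite -[LHS]mul1e -Ig -ge0_integralZr//; last exact: integral_ge0.
  apply: eq_integral => x _; rewrite -ge0_integralZl//.
  rewrite -[LHS](haar_translate x); last 2 first.
  - exact: measurable_funeM.
  - by move=> y; rewrite mule_ge0.
  by apply: eq_integral => y _; rewrite opprB.
transitivity (\int[lambda]_y \int[lambda]_x (g x * f (x - y)%R)).
  apply: (sigma_finite_tonelli (m1 := lambda) (m2 := lambda)
    (f := fun z : borel G * borel G => g z.1 * f (z.1 - z.2)%R)).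
  - exact: haar_sigma_finite.
  - exact: haar_sigma_finite.
  - apply: emeasurable_funM; first exact: (measurableT_comp mg).
    by apply: (measurableT_comp mf); exact: measurable_subGf.
  - by move=> z; rewrite mule_ge0.
transitivity (\int[lambda]_y \int[lambda]_x (g (x + y)%R * f x)).
  apply: eq_integral => y _.
  rewrite -[RHS](haar_translate y); last 2 first.
  - apply: emeasurable_funM => //; apply: (measurableT_comp mg).
    by apply: measurable_addGf => //; exact: measurable_cst.
  - by move=> x; rewrite mule_ge0.
  by apply: eq_integral => x _; rewrite subrK.
transitivity (\int[lambda]_x \int[lambda]_y (g (x + y)%R * f x)).
  apply: (sigma_finite_tonelli (m1 := lambda) (m2 := lambda)
    (f := fun z : borel G * borel G => g (z.2 + z.1)%R * f z.2)).
  - exact: haar_sigma_finite.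
  - exact: haar_sigma_finite.
  - apply: emeasurable_funM; last exact: (measurableT_comp mf).
    by apply: (measurableT_comp mg); exact: measurable_addGf.
  - by move=> z; rewrite mule_ge0.
apply: eq_integral => x _; rewrite ge0_integralZr//; last first.
  by apply: (measurableT_comp mg); apply: measurable_addGf => //; exact: measurable_cst.
by under eq_integral do rewrite addrC; rewrite haar_translateD// Ig mul1e.
Qed.

End borel_integral.

(** * A tactic for measurability *)
Lemma measurable_flowf (G : topologicalZmodType) d (Omega : measurableType d)
    (theta : borel G -> Omega -> Omega) d' (X : measurableType d')
    (f : X -> Omega) (g : X -> borel G) :
  measurable_flow theta -> measurable_fun setT f -> measurable_fun setT g ->
  measurable_fun setT (fun x => theta (g x) (f x)).
Proof.
move=> flow mf mg.
apply: (measurableT_comp (flow_measurable flow) (g := fun x => (f x, g x))).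
exact: measurable_fun_pair.
Qed.

(** Dispatch is on the syntactic shape of the function.  Letting unification
    guess the decomposition would unfold integrals down to suprema over simple
    functions. *)
Ltac measurability_step := lazymatch goal with
  | H : measurable_fun setT ?f |- measurable_fun setT ?f => exact: H
  | |- measurable_fun _ (fun _ => ?c) => exact: measurable_cst
  | |- measurable_fun _ (fun x => x) => exact: measurable_id
  | |- measurable_fun _ (fun x => x.1) => exact: measurable_fst
  | |- measurable_fun _ (fun x => x.2) => exact: measurable_snd
  | |- measurable_fun _ (fun x => (@?a x, @?b x)) => apply: measurable_fun_pair
  | |- measurable_fun _ (fun x => (@?a x * @?b x)%E) => apply: emeasurable_funM
  | |- measurable_fun _ (fun x => (@?a x - @?b x)%R) => apply: measurable_subGf
  | |- measurable_fun _ (fun x => (@?a x + @?b x)%R) => apply: measurable_addGf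
  | |- measurable_fun _ (fun x => (- @?a x)%R) => apply: measurable_oppGf
  | H : measurable_flow ?theta |-
    measurable_fun _ (fun x => ?theta (@?a x) (@?b x)) =>
      apply: (measurable_flowf H)
  | H : measurable_flow ?theta |- measurable_fun _ (?theta ?s) =>
      apply: (measurable_flowf (g := fun=> s) (f := id) H)
  | H : measurable_fun setT ?f |- measurable_fun _ (fun x => ?f (@?a x)) =>
      apply: (measurableT_comp H (g := a))
  | |- measurable_fun _ (fun x => (@?a x).1) =>
      apply: (measurableT_comp measurable_fst (g := a))
  | |- measurable_fun _ (fun x => (@?a x).2) =>
      apply: (measurableT_comp measurable_snd (g := a))
  | |- measurable_fun _ id => exact: measurable_id
  | |- measurable_fun _ ?f => first [assumption | is_var f; unfold f]
  | |- _ => assumption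
  end.

Ltac measurability := repeat measurability_step.

(** * The matching rate *)
Section rate.
Context (R : realType).
Implicit Types x y : \bar R.

(** 1 / max(x, y), and 0 when the maximum is 0 or infinite, thanks to the values
    of fine at infinity and of the inverse at 0. *)
Definition rate x y : \bar R := ((fine (maxe x y))^-1)%:E.

Lemma rateC x y : rate x y = rate y x.
Proof. by rewrite /rate maxC. Qed.

Lemma rate_ge0 x y : 0 <= x -> 0 <= rate x y.
Proof. by move=> x0; rewrite lee_fin invr_ge0 fine_ge0// le_max x0. Qed.

Lemma rateMl_le1 x y : 0 <= x -> 0 <= y -> rate x y * x <= 1.
Proof.
move=> x0 y0; rewrite /rate.
have m0 : 0 <= maxe x y by rewrite le_max x0.
have [m_fin|/negP m_nfin] := boolP (maxe x y \is a fin_num); last first.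
  move: m_nfin; case: (maxe x y) m0 => //= _ _.
  by rewrite invr0 mul0e.
have xm : x <= maxe x y by rewrite le_max lexx.
have x_fin : x \is a fin_num.
  by rewrite ge0_fin_numE// (le_lt_trans xm)// -ge0_fin_numE.
rewrite -[x in _ * x]fineK// -EFinM lee_fin mulrC.
have [->|m_neq0] := eqVneq (fine (maxe x y)) 0%R; first by rewrite invr0 mulr0.
rewrite ler_pdivrMr ?mul1r ?fine_le//.
by rewrite lt_def m_neq0 fine_ge0.
Qed.

Lemma rateMr_le1 x y : 0 <= x -> 0 <= y -> rate x y * y <= 1.
Proof. by move=> x0 y0; rewrite rateC rateMl_le1. Qed.

(** With h = rate x y, a fraction h y of the mass x and a fraction h x of the
    mass y are matched: both amount to min(x, y). *)
Lemma rate_min x y : 0 <= x < +oo -> 0 <= y < +oo -> rate x y * y * x = mine x y.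
Proof.
have main a b : 0 <= a < +oo -> 0 <= b < +oo -> a <= b -> rate a b * b * a = a.
  move=> /andP[a0 aoo] /andP[b0 boo] ab; rewrite /rate (max_idPr ab).
  have [b_eq0|b_neq0] := eqVneq b 0.
    have -> : a = 0 by apply/eqP; rewrite eq_le a0 -b_eq0 ab.
    by rewrite mule0.
  have b_fin : b \is a fin_num by rewrite ge0_fin_numE.
  rewrite -[X in _ * X * _]fineK// -EFinM mulVf ?mul1e//.
  by rewrite fine_eq0.
move=> hx hy; have [xy|/ltW yx] := leP x y; first exact: main.
by rewrite rateC -muleA [y * x]muleC muleA; exact: main.
Qed.

Lemma measurable_rate d (T : measurableType d) (f g : T -> \bar R) :
  measurable_fun setT f -> measurable_fun setT g -> (forall t, 0 <= f t) ->
  measurable_fun setT (fun t => rate (f t) (g t)).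
Proof.
move=> mf mg f0.
have -> : (fun t => rate (f t) (g t)) =
    EFin \o ((@powR R ^~ (-1)%R) \o (fine \o (fun t => maxe (f t) (g t)))).
  by apply/funext => t /=; rewrite powR_inv1// fine_ge0// le_max f0.
apply/measurable_EFinP; apply: measurableT_comp; first exact: measurable_powR.
by apply: measurableT_comp; [exact: fine_measurable|exact: measurable_maxe].
Qed.

End rate.

(** A series is an integral for the counting measure, where an infinite factor
    k may be taken out. *)
Lemma ge0_nneseriesZl (R : realType) (k : \bar R) (a : nat -> \bar R) :
  0 <= k -> (forall n, 0 <= a n) ->
  k * \sum_(n <oo) a n = \sum_(n <oo) k * a n.
Proof.
move=> k0 a0; rewrite -!ge0_integral_count//; last by move=> n; rewrite mule_ge0.
by rewrite ge0_integralZl.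
Qed.

Lemma mine_ge0 (R : realDomainType) (a b : \bar R) :
  0 <= a -> 0 <= b -> 0 <= mine a b.
Proof. by move=> a0 b0; rewrite le_min a0. Qed.

Lemma le_mine (R : realDomainType) (a b a' b' : \bar R) :
  a <= a' -> b <= b' -> mine a b <= mine a' b'.
Proof. by move=> aa' bb'; rewrite le_min !ge_min aa' bb' orbT. Qed.

Lemma mine_eq0r (R : realDomainType) (a b : \bar R) :
  mine a b = 0 -> a != 0 -> b = 0.
Proof. by rewrite /mine; case: ifP => // _ ->; rewrite eqxx. Qed.

(** * Kernels given by a density and an atom *)
Section density_kernel.
Context (R : realType) (G : topologicalZmodType).
Context (G_locally_compact : locally_compact [set: G]).
Context (G_second_countable : @second_countable G).
Context (d : measure_display) (X : measurableType d).
Context (m : X -> lfmeasure R G) (mm : measurable_fun setT m).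
Context (D : X * borel G -> \bar R) (mD : measurable_fun setT D).
Context (D0 : forall z, 0 <= D z).
Context (c : X -> \bar R) (mc : measurable_fun setT c) (c0 : forall x, 0 <= c x).
Context (g : X -> borel G) (mg : measurable_fun setT g).
Context (total : forall x, \int[m x]_u D (x, u) + c x = 1).

Definition density_kernel x (A : set (borel G)) : \bar R :=
  \int[m x]_(u in A) D (x, u) + c x * \d_(g x) A.

Let mDx x : measurable_fun setT (fun u : borel G => D (x, u)).
Proof. by measurability. Qed.

Let density_kernel0 x : density_kernel x set0 = 0.
Proof. by rewrite /density_kernel integral_set0 measure0 mule0 adde0. Qed.

Let density_kernel_ge0 x A : 0 <= density_kernel x A.
Proof. by rewrite adde_ge0 ?integral_ge0// mule_ge0. Qed.

Let density_kernel_sigma_additive x : semi_sigma_additive (density_kernel x).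
Proof.
move=> F mF tF mUF.
have -> : density_kernel x (\bigcup_n F n) = \sum_(n <oo) density_kernel x (F n).
  rewrite /density_kernel ge0_integral_bigcup//; last exact: measurable_funTS.
  rewrite measure_semi_bigcup// ge0_nneseriesZl//.
  apply/esym; apply: (@nneseriesD R (fun n => \int[m x]_(u in F n) D (x, u))
    (fun n => c x * \d_(g x) (F n)) xpredT 0%N) => n _ _.
    exact: integral_ge0.
  exact: mule_ge0.
by apply: is_cvg_nneseries => n _ _; exact: density_kernel_ge0.
Qed.

HB.instance Definition _ x := isMeasure.Build _ _ _ (density_kernel x)
  (density_kernel0 x) (density_kernel_ge0 x) (@density_kernel_sigma_additive x).

Definition density_kernel_measure x : {measure set (borel G) -> \bar R} :=
  density_kernel x.

Let measurable_density_kernel A : measurable A ->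
  measurable_fun setT (density_kernel_measure ^~ A).
Proof.
move=> mA; apply: emeasurable_funD; last first.
  apply: emeasurable_funM => //; apply/measurable_EFinP.
  rewrite (_ : (fun _ => _) = (\1_A : borel G -> R) \o g)//.
  by apply: measurableT_comp => //; exact: measurable_indic.
rewrite (_ : (fun _ => _) =
    (fun x => \int[m x]_u (D (x, u) * (\1_A u)%:E))); last first.
  apply/funext => x; rewrite integral_mkcond.
  by apply: eq_integral => u _; rewrite epatch_indic.
apply: (measurable_integral_lfmeasure G_locally_compact G_second_countable
  (f := fun z => D z * (\1_A z.2)%:E) mm) => [|z]; last by rewrite mule_ge0// lee_fin.
apply: emeasurable_funM => //; apply/measurable_EFinP.
by apply: (measurableT_comp (measurable_indic mA)).
Qed.

HB.instance Definition _ :=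
  isKernel.Build _ _ _ _ _ density_kernel_measure measurable_density_kernel.

Let density_kernel_setT x : density_kernel_measure x setT = 1.
Proof.
by rewrite -(total x) /density_kernel_measure /= /density_kernel diracT mule1.
Qed.

HB.instance Definition _ := Kernel_isProbability.Build _ _ _ _ _
  density_kernel_measure density_kernel_setT.

Lemma exists_density_kernel : exists T : R.-pker X ~> borel G,
  forall x A, T x A = \int[m x]_(u in A) D (x, u) + c x * \d_(g x) A.
Proof. by exists density_kernel_measure. Qed.

End density_kernel.

(** * Stationarity and the mass-transport principle *)
Section stationary_transport.
Context (R : realType) (G : topologicalZmodType).
Context (G_locally_compact : locally_compact [set: G]).
Context (G_second_countable : @second_countable G).
Context (lambda : {measure set (borel G) -> \bar R}).
Context (lambda_haar : haar_measure lambda).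
Context (d : measure_display) (Omega : measurableType d).
Context (theta : borel G -> Omega -> Omega).
Context (theta_flow : measurable_flow theta).
Context (P : {measure set Omega -> \bar R}).
Context (P_sigma_finite : sigma_finite [set: Omega] P).
Context (P_stationary : stationary theta P).

(** Stability under every theta_s suffices, since theta_(-s) is the inverse of
    theta_s. *)
Lemma invariant_sigma_fieldP (J : set Omega) : measurable J ->
  (forall s w, J w -> J (theta s w)) -> invariant_sigma_field theta J.
Proof.
move=> mJ J_flow; split => // s; apply/seteqP; split=> [_ [w Jw <-]|w Jw].
  exact: J_flow.
exists (theta (- s)%R w); first exact: J_flow.
by rewrite (flowD theta_flow) addrN (flow0 theta_flow).
Qed.

Lemma invariant_indic (J : set Omega) : invariant_sigma_field theta J ->
  forall s w, (\1_J (theta s w))%:E = (\1_J w)%:E :> \bar R.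
Proof.
move=> [mJ Jinv] s w; rewrite !indicE.
suff -> : (theta s w \in J) = (w \in J) by [].
apply/idP/idP; rewrite !inE => Jw; last by rewrite -(Jinv s); exists w.
rewrite -(Jinv (- s)%R); exists (theta s w) => //.
by rewrite (flowD theta_flow) addNr (flow0 theta_flow).
Qed.

Lemma integral_stationary (f : Omega -> \bar R) (s : borel G) :
  measurable_fun setT f -> (forall w, 0 <= f w) ->
  \int[P]_w f (theta s w) = \int[P]_w f w.
Proof.
move=> mf f0.
have mth : measurable_fun setT (theta s) by measurability.
transitivity (\int[pushforward P (theta s)]_w f w).
  by rewrite ge0_integral_pushforward// preimage_setT.
by apply: eq_measure_integral => A mA _; exact: P_stationary.
Qed.

Lemma integral_invariant_shift (xi : random_measure Omega R G)
    (f : borel G -> \bar R) (w : Omega) (s : borel G) :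
  invariant_random_measure theta xi ->
  measurable_fun setT f -> (forall r, 0 <= f r) ->
  \int[xi (theta s w)]_r f r = \int[xi w]_r f (r - s)%R.
Proof.
move=> xi_inv mf f0; apply: integral_shift => // B mB; exact: xi_inv.
Qed.

Lemma measurable_integral_rm d' (X : measurableType d')
    (xi : random_measure Omega R G) (h : X -> Omega)
    (f : X * borel G -> \bar R) :
  measurable_fun setT h -> measurable_fun setT f -> (forall z, 0 <= f z) ->
  measurable_fun setT (fun x => \int[xi (h x)]_s f (x, s)).
Proof.
move=> mh mf f0; apply: measurable_integral_lfmeasure => //.
exact: measurableT_comp.
Qed.

Lemma measurable_integral_haar d' (X : measurableType d')
    (f : X * borel G -> \bar R) :
  measurable_fun setT f -> (forall z, 0 <= f z) ->
  measurable_fun setT (fun x => \int[lambda]_s f (x, s)).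
Proof.
move=> mf f0.
apply: (measurable_integral_lfmeasure G_locally_compact G_second_countable
  (f := f) (m := fun=>
  LFMeasure (haar_locally_finite lambda_haar))) => //.
Qed.

Lemma integral_haar_pull (xi : random_measure Omega R G)
    (F : (Omega * borel G) * borel G -> \bar R) :
  measurable_fun setT F -> (forall z, 0 <= F z) ->
  \int[P]_w \int[xi w]_r \int[lambda]_u F (w, r, u) =
  \int[lambda]_u \int[P]_w \int[xi w]_r F (w, r, u).
Proof.
move=> mF F0.
transitivity (\int[P]_w \int[lambda]_u \int[xi w]_r F (w, r, u)).
  apply: eq_integral => w _.
  apply: (sigma_finite_tonelli (m1 := xi w) (m2 := lambda)
    (f := fun z : borel G * borel G => F (w, z.1, z.2))) => //.
  - exact: lfmeasure_sigma_finite.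
  - exact: haar_sigma_finite.
  - by measurability.
apply: (sigma_finite_tonelli (m1 := P) (m2 := lambda)
  (f := fun z : Omega * borel G => \int[xi z.1]_r F (z.1, r, z.2))) => //.
- exact: haar_sigma_finite.
- apply: (measurable_integral_rm xi (f := fun z : (Omega * borel G) * borel G =>
    F (z.1.1, z.2, z.1.2))) => //; by measurability.
- by move=> z; apply: integral_ge0.
Qed.

(** For each u, replace w by theta_u w: stationarity keeps the expectation, and
    invariance of xi turns the integral over r into one over r - u.  The
    integral over u lets a reference window move between the arguments of F;
    Campbell's formula, the conservation of smoothed mass and the necessity
    part below are all instances for a suitable F. *)
Lemma mass_transport (xi : random_measure Omega R G)
    (F : (Omega * borel G) * borel G -> \bar R) :
  invariant_random_measure theta xi ->
  measurable_fun setT F -> (forall z, 0 <= F z) ->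
  \int[P]_w \int[xi w]_r \int[lambda]_u F (w, r, u) =
  \int[P]_w \int[xi w]_r \int[lambda]_u F (theta u w, (r - u)%R, u).
Proof.
move=> xi_inv mF F0.
pose F' z := F (theta z.2 z.1.1, (z.1.2 - z.2)%R, z.2).
have mF' : measurable_fun setT F' by measurability.
transitivity (\int[lambda]_u \int[P]_w \int[xi w]_r F (w, r, u)).
  exact: integral_haar_pull.
transitivity (\int[lambda]_u \int[P]_w \int[xi w]_r F' (w, r, u)); last first.
  by apply/esym/integral_haar_pull => // z; exact: F0.
apply: eq_integral => u _.
rewrite -(integral_stationary u); last 2 first.
- apply: (measurable_integral_rm xi (f := fun z : Omega * borel G =>
    F (z.1, z.2, u))) => //; by measurability.
- by move=> w; apply: integral_ge0.
apply: eq_integral => w _; rewrite integral_invariant_shift//.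
by measurability.
Qed.

Lemma haar_reflect (f : borel G -> \bar R) (r : borel G) :
  measurable_fun setT f -> (forall x, 0 <= f x) ->
  \int[lambda]_u f (r - u)%R = \int[lambda]_u f u.
Proof.
move=> mf f0.
rewrite -[RHS](haar_opp G_locally_compact G_second_countable lambda_haar)//.
rewrite -[RHS](haar_translate G_second_countable lambda_haar r)//.
  by apply: eq_integral => u _; rewrite opprB.
by measurability; exact: measurable_oppG.
Qed.

(** Independence of the Palm measure from the reference window, with two
    arbitrary weights v and w in place of windows. *)
Lemma campbell (xi : random_measure Omega R G) (phi : Omega -> \bar R)
    (v w : borel G -> \bar R) :
  invariant_random_measure theta xi ->
  measurable_fun setT phi -> (forall x, 0 <= phi x) ->
  measurable_fun setT v -> (forall x, 0 <= v x) ->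
  measurable_fun setT w -> (forall x, 0 <= w x) ->
  (\int[lambda]_u v u) * \int[P]_o \int[xi o]_r (w r * phi (theta r o)) =
  (\int[lambda]_u w u) * \int[P]_o \int[xi o]_r (v r * phi (theta r o)).
Proof.
move=> xi_inv mphi phi0 mv v0 mw w0.
have pull (g h : borel G -> \bar R) :
    measurable_fun setT g -> (forall x, 0 <= g x) ->
    measurable_fun setT h -> (forall x, 0 <= h x) ->
    (\int[lambda]_u g u) * \int[P]_o \int[xi o]_r (h r * phi (theta r o)) =
    \int[P]_o \int[xi o]_r ((\int[lambda]_u g u) * (h r * phi (theta r o))).
  move=> mg g0 mh h0.
  have Ig0 : 0 <= \int[lambda]_u g u by exact: integral_ge0.
  have hphi0 z : 0 <= h z.2 * phi (theta z.2 z.1) by rewrite mule_ge0.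
  have mhphi : measurable_fun setT
      (fun z : Omega * borel G => h z.2 * phi (theta z.2 z.1)).
    by measurability.
  rewrite -ge0_integralZl//.
  - apply: eq_integral => o _; rewrite ge0_integralZl//.
    + by measurability.
    + by move=> r _; exact: (hphi0 (o, r)).
  - exact: (measurable_integral_rm xi
      (h := id) (f := fun z => h z.2 * phi (theta z.2 z.1))).
  - by move=> o _; apply: integral_ge0 => r _; exact: (hphi0 (o, r)).
transitivity (\int[P]_o \int[xi o]_r
    ((\int[lambda]_u v u) * (w r * phi (theta r o)))).
  exact: pull.
transitivity (\int[P]_o \int[xi o]_r
    ((\int[lambda]_u w u) * (v r * phi (theta r o)))); last first.
  by apply/esym/pull.
(* Integrating out u gives the integral of v; after the shift, that of w. *)
pose F (z : Omega * borel G * borel G) :=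
  v (z.1.2 + z.2)%R * (w z.1.2 * phi (theta z.1.2 z.1.1)).
have mF : measurable_fun setT F by measurability.
have F0 z : 0 <= F z by rewrite !mule_ge0.
transitivity (\int[P]_o \int[xi o]_r \int[lambda]_u F (o, r, u)).
  apply: eq_integral => o _; apply: eq_integral => r _; rewrite /F /=.
  rewrite ge0_integralZr//; last by rewrite mule_ge0.
    congr (_ * _); under eq_integral do rewrite addrC.
    by rewrite (haar_translateD G_second_countable lambda_haar).
  by measurability.
etransitivity; first exact: (mass_transport xi_inv mF F0).
apply: eq_integral => o _; apply: eq_integral => r _; rewrite /F /=.
transitivity (\int[lambda]_u (w (r - u)%R * (v r * phi (theta r o)))).
  apply: eq_integral => u _.
  by rewrite subrK (flowD theta_flow) subrK muleCA.
rewrite ge0_integralZr//; last by rewrite mule_ge0.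
  by rewrite haar_reflect.
by measurability.
Qed.

Let measurable_lf (zeta : random_measure Omega R G) :
  measurable_fun setT (zeta : Omega -> lfmeasure R G).
Proof. exact: measurable_funPT. Qed.

(** * Balancing kernels preserve the mass of invariant events *)
Section necessity.
Context (xi eta : random_measure Omega R G).
Context (xi_invariant : invariant_random_measure theta xi).
Context (T : R.-pker (Omega * borel G) ~> borel G).
Context (T_invariant : invariant_kernel theta T).
Context (T_balancing : ae_balancing P xi eta T).

Let T_sigma_finite x : sigma_finite setT (T x).
Proof.
apply: fin_num_fun_sigma_finite; first by rewrite measure0.
apply: lty_fin_num_fun; rewrite -ge0_fin_numE//.
by rewrite prob_kernel.
Qed.

(** Averaging the window over all its translates forgets where T sends its
    mass; only the total mass 1 remains. *)
Lemma integral_kernel_shift x B : measurable B ->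
  \int[lambda]_u T x (Defs.shift B (- u)%R) = lambda B.
Proof.
move=> mB.
have m1 := @measurable_eindic _ _ R _ mB.
have mF : measurable_fun setT (fun z : borel G * borel G =>
    (\1_B (z.2 - z.1)%R)%:E : \bar R).
  by apply: (measurableT_comp m1); measurability.
transitivity (\int[lambda]_u \int[T x]_t (\1_B (t - u)%R)%:E).
  apply: eq_integral => u _.
  have mS := measurable_shift G_second_countable (- u)%R mB.
  transitivity (\int[T x]_t (\1_(Defs.shift B (- u)%R) t)%:E).
    by rewrite integral_indic// setIT.
  apply: eq_integral => t _; rewrite !indicE shiftE.
  by congr (_%:R%:E); congr (nat_of_bool _); apply/idP/idP; rewrite !inE.
transitivity (\int[T x]_t \int[lambda]_u (\1_B (t - u)%R)%:E).
  apply: (sigma_finite_tonelli (m1 := lambda) (m2 := T x)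
    (f := fun z => (\1_B (z.2 - z.1)%R)%:E)) => //.
  - exact: haar_sigma_finite.
have b0 s : 0 <= (\1_B s)%:E :> \bar R by rewrite lee_fin.
under eq_integral do rewrite (haar_reflect _ m1 b0) integral_indic// setIT.
by rewrite integral_cst// prob_kernel mule1.
Qed.

(** Let F be the mass sent into B by the points in the window B - u.
    Integrating out u first gives lambda(B) times all the mass sent into B,
    hence the eta-mass of B.  After the mass-transport exchange, F is the mass
    sent into B + u by the points in B, and integrating out u gives lambda(B)
    times the xi-mass of B. *)
Lemma balancing_invariant_integral B J :
  measurable B -> invariant_sigma_field theta J -> 0 < lambda B < +oo ->
  \int[P]_w ((\1_J w)%:E * xi w B) = \int[P]_w ((\1_J w)%:E * eta w B).
Proof.
move=> mB hJ /andP[B0 Boo]; have [mJ _] := hJ.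
have jE := invariant_indic hJ.
have m1 := @measurable_eindic _ _ R _ mB.
have mj := @measurable_eindic _ _ R _ mJ.
have mT := measurable_kernel T B mB.
have j0 w : 0 <= (\1_J w)%:E :> \bar R by rewrite lee_fin.
have b0 s : 0 <= (\1_B s)%:E :> \bar R by rewrite lee_fin.
pose F (z : Omega * borel G * borel G) :=
  (\1_B (z.1.2 + z.2)%R)%:E * ((\1_J z.1.1)%:E * T z.1 B).
have mF : measurable_fun setT F.
  apply: emeasurable_funM; first by apply: (measurableT_comp m1); measurability.
  apply: emeasurable_funM; first by apply: (measurableT_comp mj); measurability.
  exact: (measurableT_comp mT measurable_fst).
have F0 z : 0 <= F z by rewrite !mule_ge0.
have mev (zeta : random_measure Omega R G) : measurable_fun setT (zeta ^~ B).
  exact: (measurableT_comp (measurable_lfmeasure_eval mB) (measurable_lf zeta)).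
have pull (zeta : random_measure Omega R G) :
    \int[P]_w (lambda B * ((\1_J w)%:E * zeta w B)) =
    lambda B * \int[P]_w ((\1_J w)%:E * zeta w B).
  rewrite ge0_integralZl//; exact: emeasurable_funM.
have etaE : \int[P]_w \int[xi w]_r \int[lambda]_u F (w, r, u) =
    lambda B * \int[P]_w ((\1_J w)%:E * eta w B).
  rewrite -pull; apply: ge0_ae_eq_integral => //.
  - apply: (measurable_integral_rm xi
      (h := id) (f := fun z : Omega * borel G => \int[lambda]_u F (z.1, z.2, u))) => //.
    + apply: (measurable_integral_haar (f := fun z => F (z.1.1, z.1.2, z.2))) => //.
      by measurability.
    + by move=> z; apply: integral_ge0.
  - by apply: emeasurable_funM; [exact: measurable_cst|exact: emeasurable_funM].
  - by move=> w _; apply: integral_ge0 => r _; apply: integral_ge0.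
  move: T_balancing; apply: filterS => w /(_ B mB) <- _.
  have mTw : measurable_fun setT (fun r : borel G => T (w, r) B).
    exact: (measurableT_comp mT (measurable_fun_pair (measurable_cst w)
      (@measurable_id _ _ setT))).
  rewrite muleA -ge0_integralZl//.
  apply: eq_integral => r _; rewrite /F /= ge0_integralZr//.
  - under eq_integral do rewrite addrC.
    rewrite (haar_translateD G_second_countable lambda_haar
      (f := fun s => (\1_B s)%:E))//.
    by rewrite integral_indic// setIT muleA.
  - exact: (measurableT_comp m1 (measurable_addGf G_second_countable
      (measurable_cst r) (@measurable_id _ _ setT))).
have xiE : \int[P]_w \int[xi w]_r \int[lambda]_u F (w, r, u) =
    lambda B * \int[P]_w ((\1_J w)%:E * xi w B).
  rewrite -pull; apply: etrans.
    exact: (mass_transport xi_invariant mF F0).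
  apply: eq_integral => w _.
  transitivity (\int[xi w]_r (lambda B * (\1_J w)%:E * (\1_B r)%:E)); last first.
    rewrite ge0_integralZl//.
    by rewrite integral_indic// setIT muleA.
  apply: eq_integral => r _; rewrite -(integral_kernel_shift (w, r) mB).
  have mK : measurable_fun setT (fun u : borel G => T (w, r) (Defs.shift B (- u)%R)).
    have mG : measurable_fun setT (fun u : borel G => T (theta u w, (r - u)%R) B).
      by apply: (measurableT_comp mT); measurability.
    apply: eq_measurable_fun mG => u _.
    rewrite -(T_invariant r u); last exact: measurable_shift.
    congr (T _ _); rewrite !shiftE; apply/seteqP.
    by split=> x /=; rewrite addrK.
  rewrite -muleA -ge0_integralZr//.
  apply: eq_integral => u _; rewrite /F /= subrK jE.
  rewrite -(T_invariant r u w); last exact: measurable_shift.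
  have -> : Defs.shift (Defs.shift B (- u)%R) u = B.
    by rewrite !shiftE; apply/seteqP; split=> x /=; rewrite addrK.
  by rewrite muleCA muleA [RHS]muleC.
have B_fin : lambda B \is a fin_num by rewrite ge0_fin_numE// ltW.
have h : lambda B * \int[P]_w ((\1_J w)%:E * xi w B) =
    lambda B * \int[P]_w ((\1_J w)%:E * eta w B).
  exact: (etrans (esym xiE) etaE).
have B_inv x : (fine (lambda B))^-1%:E * (lambda B * x) = x.
  rewrite muleA -[X in _ * X * _]fineK// -EFinM mulVf ?mul1e// gt_eqF//.
  by rewrite fine_gt0 ?B0.
by rewrite -[LHS]B_inv h B_inv.
Qed.

End necessity.

(** * Smoothing a random measure *)
Context (p : borel G -> \bar R).
Context (p_measurable : measurable_fun setT p) (p_gt0 : forall s, 0 < p s).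
Context (p_integral : \int[lambda]_s p s = 1).

Let p_ge0 s : 0 <= p s. Proof. exact: ltW. Qed.

(** The density at the origin after each point r of xi, carrying mass
    f (theta_r w), is spread over G with density s |-> p (s - r); the density
    at s is given by [smooth_flow]. *)
Definition smooth (xi : random_measure Omega R G) (f : Omega -> \bar R)
    (w : Omega) : \bar R :=
  \int[xi w]_r (p (- r)%R * f (theta r w)).

(** Seen from a point placed at the origin, the mean of h over the places where
    the mass of this point is spread. *)
Definition average (h : Omega -> \bar R) (w : Omega) : \bar R :=
  \int[lambda]_s (p s * h (theta s w)).

Lemma measurable_smooth xi f : measurable_fun setT f -> (forall w, 0 <= f w) ->
  measurable_fun setT (smooth xi f).
Proof.
move=> mf f0.
apply: (measurable_integral_rm xi
  (h := id) (f := fun z => p (- z.2)%R * f (theta z.2 z.1))) => //.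
  by measurability.
by move=> z; rewrite mule_ge0.
Qed.

Lemma smooth_ge0 xi f w : (forall w, 0 <= f w) -> 0 <= smooth xi f w.
Proof. by move=> f0; apply: integral_ge0 => r _; rewrite mule_ge0. Qed.

Lemma measurable_average h : measurable_fun setT h -> (forall w, 0 <= h w) ->
  measurable_fun setT (average h).
Proof.
move=> mh h0.
apply: (measurable_integral_haar
  (f := fun z => p z.2 * h (theta z.2 z.1))) => //.
  by measurability.
by move=> z; rewrite mule_ge0.
Qed.

Lemma average_ge0 h w : (forall w, 0 <= h w) -> 0 <= average h w.
Proof. by move=> h0; apply: integral_ge0 => r _; rewrite mule_ge0. Qed.

Lemma average_le1 h w : measurable_fun setT h -> (forall w, 0 <= h w <= 1) ->
  average h w <= 1.
Proof.
move=> mh h01; rewrite -p_integral; apply: ge0_le_integral => //.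
- by move=> s _; rewrite mule_ge0//; case/andP: (h01 (theta s w)).
- by measurability.
- by move=> s _; rewrite -[leRHS]mule1 lee_wpmul2l//; case/andP: (h01 (theta s w)).
Qed.

Lemma smooth_flow xi f w s : invariant_random_measure theta xi ->
  measurable_fun setT f -> (forall w, 0 <= f w) ->
  smooth xi f (theta s w) = \int[xi w]_r (p (s - r)%R * f (theta r w)).
Proof.
move=> xi_inv mf f0; rewrite /smooth.
rewrite (integral_invariant_shift
  (f := fun r => p (- r)%R * f (theta r (theta s w))) _ _ xi_inv)//.
- apply: eq_integral => r _.
  by rewrite opprB (flowD theta_flow) subrK.
- by measurability.
- by move=> r; rewrite mule_ge0.
Qed.

Lemma average_flow h w t : measurable_fun setT h -> (forall w, 0 <= h w) ->
  average h (theta t w) = \int[lambda]_s (p (s - t)%R * h (theta s w)).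
Proof.
move=> mh h0; rewrite /average.
rewrite -(haar_translate G_second_countable lambda_haar t).
- by apply: eq_integral => r _; rewrite (flowD theta_flow) subrK.
- by measurability.
- by move=> r; rewrite mule_ge0.
Qed.

(** If the place s accepts a fraction h (theta_s w) of the mass spread there,
    the accepted mass can be counted either where it came from or where it is
    accepted. *)
Lemma smooth_average xi f h : invariant_random_measure theta xi ->
  measurable_fun setT f -> (forall w, 0 <= f w) ->
  measurable_fun setT h -> (forall w, 0 <= h w) ->
  \int[P]_w smooth xi (fun w => f w * average h w) w =
  \int[P]_w (h w * smooth xi f w).
Proof.
move=> xi_inv mf f0 mh h0.
(* The factor p (- r - u) has integral 1 in u and becomes p (- r) after the
   shift, while p (- r) becomes p (u - r). *)
pose F (z : Omega * borel G * borel G) :=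
  p (- z.1.2 - z.2)%R * (p (- z.1.2)%R * f (theta z.1.2 z.1.1) * h z.1.1).
have mF : measurable_fun setT F by measurability.
have F0 z : 0 <= F z by rewrite !mule_ge0.
transitivity (\int[P]_w \int[xi w]_r \int[lambda]_u F (w, r, u)); last first.
  apply: eq_integral => w _; rewrite /smooth -ge0_integralZl//; last 2 first.
  - by measurability.
  - by move=> r _; rewrite mule_ge0.
  apply: eq_integral => r _; rewrite /F /= ge0_integralZr//; last 2 first.
  - by measurability.
  - by rewrite !mule_ge0.
  by rewrite haar_reflect// p_integral mul1e muleC.
apply/esym; etransitivity; first exact: (mass_transport xi_inv mF F0).
apply/esym; apply: eq_integral => w _; apply: eq_integral => r _; rewrite /F /=.
rewrite average_flow// muleA -ge0_integralZl//; last 3 first.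
- by measurability.
- by move=> s _; rewrite mule_ge0.
- by rewrite mule_ge0.
apply: eq_integral => u _.
rewrite (flowD theta_flow) subrK !opprB addrAC subrr add0r !muleA.
by congr (_ * _); rewrite -!muleA; congr (_ * _); rewrite muleC.
Qed.

Implicit Types (xi eta : random_measure Omega R G) (w : Omega).

(** * Greedy matching *)

(** The fraction of the smoothed mass of xi accepted at the origin, when xi and
    eta carry the remaining fractions f and g. *)
Definition acceptance xi eta (f g : Omega -> \bar R) w : \bar R :=
  rate (smooth xi f w) (smooth eta g w) * smooth eta g w.

(** The fraction of the xi-mass at the origin that remains after n rounds.
    Matching treats both measures alike, so the fraction for eta is the same
    function with the arguments exchanged. *)
Fixpoint residue n xi eta : Omega -> \bar R :=
  if n is m.+1 then fun w => residue m xi eta w *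
    (1 - average (acceptance xi eta (residue m xi eta) (residue m eta xi)) w)
  else cst 1.

Definition matched n xi eta w : \bar R := residue n xi eta w *
  average (acceptance xi eta (residue n xi eta) (residue n eta xi)) w.

Definition unmatched xi eta w : \bar R := 1 - \sum_(n <oo) matched n xi eta w.

Lemma acceptance_ge0 xi eta f g w :
  (forall w, 0 <= f w) -> (forall w, 0 <= g w) -> 0 <= acceptance xi eta f g w.
Proof.
by move=> f0 g0; rewrite mule_ge0 ?rate_ge0 ?smooth_ge0.
Qed.

Lemma acceptance_le1 xi eta f g w :
  (forall w, 0 <= f w) -> (forall w, 0 <= g w) -> acceptance xi eta f g w <= 1.
Proof. by move=> f0 g0; rewrite rateMr_le1 ?smooth_ge0. Qed.

Lemma measurable_acceptance xi eta f g :
  measurable_fun setT f -> (forall w, 0 <= f w) ->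
  measurable_fun setT g -> (forall w, 0 <= g w) ->
  measurable_fun setT (acceptance xi eta f g).
Proof.
move=> mf f0 mg g0.
have mX : measurable_fun setT (smooth xi f) by exact: measurable_smooth.
have mY : measurable_fun setT (smooth eta g) by exact: measurable_smooth.
apply: emeasurable_funM => //; apply: measurable_rate => // w.
exact: smooth_ge0.
Qed.

Lemma residue_spec n xi eta : measurable_fun setT (residue n xi eta) /\
  forall w, 0 <= residue n xi eta w <= 1.
Proof.
elim: n xi eta => [|n IH] xi eta /=.
  by split=> [|w]; [exact: measurable_cst|rewrite lee01 lexx].
have [mf f01] := IH xi eta; have [mg g01] := IH eta xi.
have f0 w : 0 <= residue n xi eta w by case/andP: (f01 w).
have g0 w : 0 <= residue n eta xi w by case/andP: (g01 w).
set h := acceptance _ _ _ _.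
have mh : measurable_fun setT h by exact: measurable_acceptance.
have h0 w : 0 <= h w by exact: acceptance_ge0.
have h01 w : 0 <= h w <= 1 by rewrite h0 acceptance_le1.
have mA : measurable_fun setT (average h) by exact: measurable_average.
have A0 w : 0 <= average h w by exact: average_ge0.
have A1 w : average h w <= 1 by exact: average_le1.
have B0 w : 0 <= 1 - average h w by rewrite sube_ge0 ?orbT.
split=> [|w].
  by apply: emeasurable_funM => //; exact: emeasurable_funB.
rewrite mule_ge0//=; apply: (@le_trans _ _ (residue n xi eta w * 1)).
  by rewrite lee_wpmul2l// leeBlDr ?leeDl// ge0_fin_numE// (le_lt_trans (A1 w)) ?ltry.
by rewrite mule1; case/andP: (f01 w).
Qed.

Lemma measurable_residue n xi eta : measurable_fun setT (residue n xi eta).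
Proof. by have [] := residue_spec n xi eta. Qed.

Lemma residue_ge0 n xi eta w : 0 <= residue n xi eta w.
Proof. by have [_ /(_ w)/andP[]] := residue_spec n xi eta. Qed.

Lemma residue_le1 n xi eta w : residue n xi eta w <= 1.
Proof. by have [_ /(_ w)/andP[]] := residue_spec n xi eta. Qed.

Local Notation accept n xi eta :=
  (acceptance xi eta (residue n xi eta) (residue n eta xi)).

Lemma measurable_accept n xi eta : measurable_fun setT (accept n xi eta).
Proof.
by apply: measurable_acceptance => [|w| |w];
  [exact: measurable_residue|exact: residue_ge0
  |exact: measurable_residue|exact: residue_ge0].
Qed.

Lemma accept_ge0 n xi eta w : 0 <= accept n xi eta w.
Proof. by apply: acceptance_ge0 => w'; exact: residue_ge0. Qed.

Lemma accept_le1 n xi eta w : accept n xi eta w <= 1.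
Proof. by apply: acceptance_le1 => w'; exact: residue_ge0. Qed.

Lemma measurable_matched n xi eta : measurable_fun setT (matched n xi eta).
Proof.
apply: emeasurable_funM; first exact: measurable_residue.
apply: measurable_average => // [|w]; first exact: measurable_accept.
exact: accept_ge0.
Qed.

Lemma matched_ge0 n xi eta w : 0 <= matched n xi eta w.
Proof.
rewrite mule_ge0 ?residue_ge0//.
by apply: average_ge0 => // w'; exact: accept_ge0.
Qed.

Lemma residueE n xi eta w :
  residue n xi eta w = matched n xi eta w + residue n.+1 xi eta w.
Proof.
rewrite /matched /=; set a := average _ w.
have a0 : 0 <= a by apply: average_ge0 => // w'; exact: accept_ge0.
have a1 : a <= 1.
  apply: average_le1 => // [|w']; first exact: measurable_accept.
  by rewrite accept_ge0 accept_le1.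
have a_fin : a \is a fin_num by rewrite ge0_fin_numE// (le_lt_trans a1) ?ltry.
have b0 : 0 <= 1 - a by rewrite sube_ge0 ?a_fin.
by rewrite -ge0_muleDr// addeC subeK// mule1.
Qed.

Lemma sum_matched n xi eta w :
  \sum_(0 <= k < n) matched k xi eta w + residue n xi eta w = 1.
Proof.
elim: n => [|n IH]; first by rewrite big_geq// add0e.
by rewrite big_nat_recr//= -addeA -residueE.
Qed.

Lemma series_matched_le1 xi eta w : \sum_(n <oo) matched n xi eta w <= 1.
Proof.
apply: lime_le; first by apply: is_cvg_nneseries => n _ _; exact: matched_ge0.
apply: nearW => n; rewrite -(sum_matched n xi eta w) leeDl//.
exact: residue_ge0.
Qed.

Lemma series_matched_ge0 xi eta w : 0 <= \sum_(n <oo) matched n xi eta w.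
Proof. by apply: nneseries_ge0 => n _ _; exact: matched_ge0. Qed.

Lemma series_matched_fin xi eta w : \sum_(n <oo) matched n xi eta w \is a fin_num.
Proof.
rewrite ge0_fin_numE ?series_matched_ge0//.
by rewrite (le_lt_trans (series_matched_le1 xi eta w)) ?ltry.
Qed.

Lemma unmatchedE xi eta w :
  \sum_(n <oo) matched n xi eta w + unmatched xi eta w = 1.
Proof. by rewrite addeC subeK// series_matched_fin. Qed.

Lemma unmatched_ge0 xi eta w : 0 <= unmatched xi eta w.
Proof. by rewrite sube_ge0 ?series_matched_le1// series_matched_fin. Qed.

Lemma unmatched_le_residue n xi eta w : unmatched xi eta w <= residue n xi eta w.
Proof.
rewrite leeBlDr ?series_matched_fin// -(sum_matched n xi eta w) addeC leeD2l//.
by apply: nneseries_lim_ge => k _ _; exact: matched_ge0.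
Qed.

Lemma measurable_series_matched xi eta :
  measurable_fun setT (fun w => \sum_(n <oo) matched n xi eta w).
Proof.
apply: ge0_emeasurable_sum => [n w _ _|n _]; first exact: matched_ge0.
exact: measurable_matched.
Qed.

Lemma measurable_unmatched xi eta : measurable_fun setT (unmatched xi eta).
Proof.
apply: emeasurable_funB; first exact: measurable_cst.
exact: measurable_series_matched.
Qed.

(** * Nothing is left over *)

#[local] Hint Resolve measurable_residue residue_ge0 residue_le1
  measurable_accept accept_ge0 measurable_matched matched_ge0
  measurable_series_matched series_matched_ge0
  measurable_unmatched unmatched_ge0 unmatched_le_residue : core.

Let measurable_smooth_integrand xi f w : measurable_fun setT f ->
  measurable_fun setT (fun r : borel G => p (- r)%R * f (theta r w)).
Proof. by move=> mf; measurability. Qed.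

Lemma smooth_invariantM xi j f w :
  (forall s w, j (theta s w) = j w) -> (forall w, 0 <= j w) ->
  measurable_fun setT f -> (forall w, 0 <= f w) ->
  smooth xi (fun w => j w * f w) w = j w * smooth xi f w.
Proof.
move=> j_inv j0 mf f0; rewrite /smooth -ge0_integralZl//.
- by apply: eq_integral => r _; rewrite j_inv muleCA.
- exact: measurable_smooth_integrand.
- by move=> r _; rewrite mule_ge0.
Qed.

Lemma average_invariantM j h w :
  (forall s w, j (theta s w) = j w) -> (forall w, 0 <= j w) ->
  measurable_fun setT h -> (forall w, 0 <= h w) ->
  average (fun w => j w * h w) w = j w * average h w.
Proof.
move=> j_inv j0 mh h0; rewrite /average -ge0_integralZl//.
- by apply: eq_integral => r _; rewrite j_inv muleCA.
- by measurability.
- by move=> r _; rewrite mule_ge0.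
Qed.

Lemma smooth_le xi f g w : measurable_fun setT f -> (forall w, 0 <= f w) ->
  measurable_fun setT g -> (forall w, f w <= g w) ->
  smooth xi f w <= smooth xi g w.
Proof.
move=> mf f0 mg fg; apply: ge0_le_integral => //.
- by move=> r _; rewrite mule_ge0.
- exact: measurable_smooth_integrand.
- exact: measurable_smooth_integrand.
- by move=> r _; rewrite lee_wpmul2l.
Qed.

Lemma smoothD xi f g w : measurable_fun setT f -> (forall w, 0 <= f w) ->
  measurable_fun setT g -> (forall w, 0 <= g w) ->
  smooth xi (fun w => f w + g w) w = smooth xi f w + smooth xi g w.
Proof.
move=> mf f0 mg g0; rewrite /smooth -ge0_integralD//.
- by apply: eq_integral => r _; rewrite ge0_muleDr.
- by move=> r _; rewrite mule_ge0.
- exact: measurable_smooth_integrand.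
- by move=> r _; rewrite mule_ge0.
- exact: measurable_smooth_integrand.
Qed.

Lemma smooth_series xi (f : nat -> Omega -> \bar R) w :
  (forall n, measurable_fun setT (f n)) -> (forall n w, 0 <= f n w) ->
  smooth xi (fun w => \sum_(n <oo) f n w) w = \sum_(n <oo) smooth xi (f n) w.
Proof.
move=> mf f0; rewrite /smooth -integral_nneseries//.
- by apply: eq_integral => r _; rewrite ge0_nneseriesZl.
- by move=> n; exact: measurable_smooth_integrand.
- by move=> n r _; rewrite mule_ge0.
Qed.

(** As p is strictly positive, the smoothed mass sees every point of xi. *)
Lemma smooth_eq0_ae xi f w : measurable_fun setT f -> (forall w, 0 <= f w) ->
  smooth xi f w = 0 -> {ae xi w, forall r, f (theta r w) = 0}.
Proof.
move=> mf f0 /ge0_integral_eq0_ae h.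
have : {ae xi w, forall r : borel G, p (- r)%R * f (theta r w) = 0}.
  apply: h => [|r]; last by rewrite mule_ge0.
  exact: measurable_smooth_integrand.
apply: filterS => r /eqP; rewrite mule_eq0 => /orP[/eqP pr0|/eqP//].
by have := p_gt0 (- r)%R; rewrite pr0 ltxx.
Qed.

(** By [smooth_eq0_ae] the vanishing of the smoothed mass means that xi gives no
    mass to f, and this does not depend on the place s. *)
Lemma smooth_eq0_flow xi f w s : invariant_random_measure theta xi ->
  measurable_fun setT f -> (forall w, 0 <= f w) ->
  smooth xi f w = 0 -> smooth xi f (theta s w) = 0.
Proof.
move=> xi_inv mf f0 /(smooth_eq0_ae mf f0) fw0.
rewrite smooth_flow//.
have -> : 0 = \int[xi w]_r (cst 0 r) by rewrite integral0.
apply: ge0_ae_eq_integral => //.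
- by measurability.
- by move=> r _; rewrite mule_ge0.
- by move: fw0; apply: filterS => r fr0 _; rewrite fr0 mule0.
Qed.

(** Mass matched by the points of xi, counted at the places of the matching; the
    invariant weight j passes through smoothing and averaging. *)
Lemma integral_matched n xi eta j :
  invariant_random_measure theta xi ->
  measurable_fun setT j -> (forall s w, j (theta s w) = j w) ->
  (forall w, 0 <= j w) ->
  \int[P]_w (j w * smooth xi (matched n xi eta) w) =
  \int[P]_w (j w * (accept n xi eta w * smooth xi (residue n xi eta) w)).
Proof.
move=> xi_inv mj j_inv j0.
pose h w := j w * accept n xi eta w.
have mh : measurable_fun setT h by exact: emeasurable_funM.
have h0 w : 0 <= h w by rewrite mule_ge0.
transitivity (\int[P]_w smooth xi (fun w => residue n xi eta w * average h w) w).
  apply: eq_integral => w _; rewrite -smooth_invariantM//.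
  congr (smooth _ _ _); apply/funext => w' /=.
  by rewrite average_invariantM// muleCA.
transitivity (\int[P]_w (h w * smooth xi (residue n xi eta) w)).
  exact: smooth_average.
by apply: eq_integral => w _; rewrite muleA.
Qed.

(** Both sides are the product of the rate and of the two smoothed masses: a
    round removes the same amount from xi and from eta at every place. *)
Lemma exchange_sym n xi eta w :
  accept n xi eta w * smooth xi (residue n xi eta) w =
  accept n eta xi w * smooth eta (residue n eta xi) w.
Proof. by rewrite /acceptance rateC muleAC. Qed.

Lemma smooth_total xi eta w : smooth xi (cst 1) w =
  \sum_(n <oo) smooth xi (matched n xi eta) w + smooth xi (unmatched xi eta) w.
Proof.
rewrite -smooth_series// -smoothD//.
by congr (smooth _ _ _); apply/funext => w' /=; rewrite unmatchedE.
Qed.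

Lemma integral_total xi eta j : measurable_fun setT j -> (forall w, 0 <= j w) ->
  \int[P]_w (j w * smooth xi (cst 1) w) =
  \sum_(n <oo) \int[P]_w (j w * smooth xi (matched n xi eta) w) +
  \int[P]_w (j w * smooth xi (unmatched xi eta) w).
Proof.
move=> mj j0.
have mM n : measurable_fun setT (fun w => j w * smooth xi (matched n xi eta) w).
  by apply: emeasurable_funM => //; exact: measurable_smooth.
have M0 n w : 0 <= j w * smooth xi (matched n xi eta) w.
  by rewrite mule_ge0// smooth_ge0.
rewrite -integral_nneseries// -ge0_integralD//.
- apply: eq_integral => w _; rewrite (smooth_total xi eta).
  rewrite ge0_muleDr ?smooth_ge0//; last first.
    by apply: nneseries_ge0 => n _ _; exact: smooth_ge0.
  by rewrite ge0_nneseriesZl// => n; exact: smooth_ge0.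
- by move=> w _; apply: nneseries_ge0.
- exact: ge0_emeasurable_sum.
- by move=> w _; rewrite mule_ge0// smooth_ge0.
- by apply: emeasurable_funM => //; exact: measurable_smooth.
Qed.

Section greedy_balance.
Context (xi eta : random_measure Omega R G).
Context (xi_invariant : invariant_random_measure theta xi).
Context (eta_invariant : invariant_random_measure theta eta).
Context (smooth_balance : forall J, invariant_sigma_field theta J ->
  \int[P]_w ((\1_J w)%:E * smooth xi (cst 1) w) =
  \int[P]_w ((\1_J w)%:E * smooth eta (cst 1) w)).
Context (smooth_finite : \int[P]_w smooth xi (cst 1) w < +oo).

Let measurable_1 J : measurable J ->
  measurable_fun setT (fun w : Omega => (\1_J w)%:E : \bar R).
Proof. exact: measurable_eindic. Qed.

Let measurable_one : measurable_fun setT (cst 1 : Omega -> \bar R).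
Proof. exact: measurable_cst. Qed.

Let invariantT : invariant_sigma_field theta setT.
Proof. exact: invariant_sigma_fieldP. Qed.

Let one_ge0 (w : Omega) : 0 <= cst 1 w :> \bar R. Proof. exact: lee01. Qed.

Let matched_mass_finite J : measurable J ->
  \sum_(n <oo) \int[P]_w ((\1_J w)%:E * smooth xi (matched n xi eta) w) < +oo.
Proof.
move=> mJ; apply: le_lt_trans smooth_finite.
apply: (@le_trans _ _ (\int[P]_w ((\1_J w)%:E * smooth xi (cst 1) w))).
  rewrite (integral_total xi eta (measurable_1 mJ))//.
  apply: leeDl; apply: integral_ge0 => w _.
  by rewrite mule_ge0 ?smooth_ge0 ?lee_fin.
apply: ge0_le_integral => //.
- by move=> w _; rewrite mule_ge0 ?smooth_ge0 ?lee_fin.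
- by apply: emeasurable_funM; [exact: measurable_1|exact: measurable_smooth].
- exact: measurable_smooth.
- move=> w _; rewrite indicE; case: (_ \in _); rewrite ?mul1e// mul0e.
  exact: smooth_ge0.
Qed.

(** Equal totals minus equal, finite matched masses. *)
Lemma unmatched_balance J : invariant_sigma_field theta J ->
  \int[P]_w ((\1_J w)%:E * smooth xi (unmatched xi eta) w) =
  \int[P]_w ((\1_J w)%:E * smooth eta (unmatched eta xi) w).
Proof.
move=> J_inv; have [mJ _] := J_inv.
have m1 := measurable_1 mJ.
have j0 w : 0 <= (\1_J w)%:E :> \bar R by rewrite lee_fin.
have j_inv := invariant_indic J_inv.
pose S := \sum_(n <oo) \int[P]_w ((\1_J w)%:E * smooth xi (matched n xi eta) w).
pose S' := \sum_(n <oo) \int[P]_w ((\1_J w)%:E * smooth eta (matched n eta xi) w).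
have SE : S = S'.
  apply: eq_eseriesr => n _.
  transitivity (\int[P]_w
      ((\1_J w)%:E * (accept n xi eta w * smooth xi (residue n xi eta) w))).
    exact: integral_matched.
  transitivity (\int[P]_w
      ((\1_J w)%:E * (accept n eta xi w * smooth eta (residue n eta xi) w))).
    by apply: eq_integral => w _; rewrite exchange_sym.
  by apply/esym; exact: integral_matched.
have S_fin : S \is a fin_num.
  rewrite ge0_fin_numE; first exact: matched_mass_finite.
  apply: nneseries_ge0 => n _ _; apply: integral_ge0 => w _.
  by rewrite mule_ge0 ?smooth_ge0.
pose U := \int[P]_w ((\1_J w)%:E * smooth xi (unmatched xi eta) w).
pose U' := \int[P]_w ((\1_J w)%:E * smooth eta (unmatched eta xi) w).
have xiE : \int[P]_w ((\1_J w)%:E * smooth xi (cst 1) w) = S + U.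
  exact: integral_total.
have etaE : \int[P]_w ((\1_J w)%:E * smooth eta (cst 1) w) = S' + U'.
  exact: integral_total.
have cancel (a b c : \bar R) : a \is a fin_num -> a + b = a + c -> b = c.
  move=> a_fin abc.
  by rewrite -[LHS](addeK b a_fin) [b + a]addeC abc [a + c]addeC addeK.
apply: (cancel S U U' S_fin).
exact: (etrans (esym xiE) (etrans (smooth_balance J_inv)
  (etrans etaE (congr1 (fun x => x + U') (esym SE))))).
Qed.

Let smooth_eta_finite : \int[P]_w smooth eta (cst 1) w < +oo.
Proof.
have <- : \int[P]_w smooth xi (cst 1) w = \int[P]_w smooth eta (cst 1) w.
  have := smooth_balance invariantT.
  by under eq_integral do rewrite indicT mul1e;
     under [in RHS]eq_integral do rewrite indicT mul1e.
exact: smooth_finite.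
Qed.

Let smooth_residue_finite (zeta zeta' : random_measure Omega R G) :
  \int[P]_w smooth zeta (cst 1) w < +oo ->
  {ae P, forall w, forall n, smooth zeta (residue n zeta zeta') w < +oo}.
Proof.
move=> fin.
have /integrable_ae : P.-integrable setT (smooth zeta (cst 1)).
  apply/integrableP; split; first exact: measurable_smooth.
  by under eq_integral do rewrite gee0_abs ?smooth_ge0//.
move=> /(_ measurableT); apply: filterS => w /(_ I).
rewrite ge0_fin_numE ?smooth_ge0// => fw n; apply: le_lt_trans fw.
by apply: smooth_le => // w'; exact: residue_le1.
Qed.

(** The minimum of the leftovers is at most the amount exchanged in any round,
    and the expected amounts have a finite sum. *)
Lemma unmatched_disjoint :
  {ae P, forall w, mine (smooth xi (unmatched xi eta) w)
                        (smooth eta (unmatched eta xi) w) = 0}.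
Proof.
pose m w := mine (smooth xi (unmatched xi eta) w) (smooth eta (unmatched eta xi) w).
have mm : measurable_fun setT m.
  by apply: measurable_mine; exact: measurable_smooth.
have m0 w : 0 <= m w by apply: mine_ge0; exact: smooth_ge0.
apply: (ge0_integral_eq0_ae mm m0).
pose a n := \int[P]_w (smooth xi (matched n xi eta) w).
have a0 n : 0 <= a n by apply: integral_ge0 => w _; exact: smooth_ge0.
have a_fin : \sum_(n <oo) a n < +oo.
  have := matched_mass_finite (@measurableT _ Omega).
  rewrite (@eq_eseriesr _ _ a)// => n _.
  by apply: eq_integral => w _; rewrite indicT mul1e.
(* Finiteness of the smoothed masses, which makes the rate exact, holds almost
   surely because they have finite expectation. *)
have m_le n : \int[P]_w m w <= a n.
  have -> : a n = \int[P]_w (accept n xi eta w * smooth xi (residue n xi eta) w).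
    have := @integral_matched n xi eta (cst 1) xi_invariant measurable_one
      (fun _ _ => erefl) one_ge0.
    by under eq_integral do rewrite mul1e; under [in RHS]eq_integral do rewrite mul1e.
  apply: ae_ge0_le_integral => //.
  - by move=> w _; rewrite mule_ge0 ?smooth_ge0.
  - by apply: emeasurable_funM => //; exact: measurable_smooth.
  have := smooth_residue_finite eta smooth_finite.
  have := smooth_residue_finite xi smooth_eta_finite.
  apply: filterS2 => w etaw xiw _; rewrite /acceptance.
  have X_fin : 0 <= smooth xi (residue n xi eta) w < +oo.
    by rewrite smooth_ge0//= xiw.
  have Y_fin : 0 <= smooth eta (residue n eta xi) w < +oo.
    by rewrite smooth_ge0//= etaw.
  rewrite (rate_min X_fin Y_fin).
  by apply: le_mine; apply: smooth_le => // w'; exact: unmatched_le_residue.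
apply/eqP; rewrite eq_le integral_ge0// andbT.
have tail : \sum_(N <= n <oo) a n @[N --> \oo] --> 0 by exact: nneseries_tail_cvg.
rewrite -(cvg_lim _ tail)//; apply: lime_ge; first by apply/cvg_ex; exists 0.
apply: nearW => N; apply: le_trans (m_le N) _.
have := @nneseries_lim_ge R a xpredT N N.+1 (fun n _ _ => a0 n).
by rewrite big_nat1.
Qed.

(** The event that xi has leftovers is invariant; on it eta has none, so the
    expected leftovers of xi there are 0 by balance. *)
Lemma unmatched_negligible : {ae P, forall w, smooth xi (unmatched xi eta) w = 0}.
Proof.
pose X := smooth xi (unmatched xi eta).
have mX : measurable_fun setT X by exact: measurable_smooth.
have X0 w : 0 <= X w by exact: smooth_ge0.
pose J := [set w | X w != 0].
have mJ : measurable J.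
  by rewrite -[J]setTI; apply: emeasurable_neq.
have J_flow s w : J w -> J (theta s w).
  rewrite /J /=; apply: contra_neq => Xs.
  rewrite -[w](flow0 theta_flow) -(addNr s) -(flowD theta_flow).
  exact: smooth_eq0_flow.
have J_inv : invariant_sigma_field theta J by exact: invariant_sigma_fieldP.
apply: (ge0_integral_eq0_ae mX X0).
transitivity (\int[P]_w ((\1_J w)%:E * X w)).
  apply: eq_integral => w _; rewrite indicE.
  have [|/negP] := boolP (w \in J); first by rewrite mul1e.
  by rewrite inE /J /= => /negP/negPn/eqP ->; rewrite mule0.
rewrite /X unmatched_balance//.
have -> : 0 = \int[P]_w (cst 0 w) by rewrite integral0.
apply: ge0_ae_eq_integral => //.
- apply: emeasurable_funM; first exact: measurable_1.
  exact: measurable_smooth.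
- by move=> w _; rewrite mule_ge0 ?smooth_ge0 ?lee_fin.
apply: filterS unmatched_disjoint => w mw _ /=.
rewrite indicE; have [|] := boolP (w \in J); last by rewrite mul0e.
by rewrite inE mul1e => /(mine_eq0r mw).
Qed.

End greedy_balance.

(** * The transport density *)

(** The rate of meeting of two masses spread from t and from u, summed over the
    meeting places s where it is weighted by z. *)
Definition coupling (z : Omega -> \bar R) w t u : \bar R :=
  \int[lambda]_s (p (s - t)%R * (p (s - u)%R * z (theta s w))).

Lemma couplingC z w t u : coupling z w t u = coupling z w u t.
Proof. by apply: eq_integral => s _; rewrite muleCA. Qed.

Lemma coupling_ge0 z w t u : (forall w, 0 <= z w) -> 0 <= coupling z w t u.
Proof. by move=> z0; apply: integral_ge0 => s _; rewrite !mule_ge0. Qed.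

Lemma measurable_coupling z : measurable_fun setT z -> (forall w, 0 <= z w) ->
  measurable_fun setT
    (fun x : Omega * borel G * borel G => coupling z x.1.1 x.1.2 x.2).
Proof.
move=> mz z0.
apply: (measurable_integral_haar
  (f := fun x : (Omega * borel G * borel G) * borel G =>
    p (x.2 - x.1.1.2)%R * (p (x.2 - x.1.2)%R * z (theta x.2 x.1.1.1)))).
  by measurability.
by move=> x; rewrite !mule_ge0.
Qed.

Lemma coupling_flow z w t u v : measurable_fun setT z -> (forall w, 0 <= z w) ->
  coupling z (theta v w) (t - v)%R (u - v)%R = coupling z w t u.
Proof.
move=> mz z0; rewrite /coupling.
rewrite -[LHS](haar_translate G_second_countable lambda_haar v).
- apply: eq_integral => s _; rewrite (flowD theta_flow) subrK.
  by rewrite !opprB !addrA !subrK.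
- by measurability.
- by move=> s; rewrite !mule_ge0.
Qed.

(** Integrating out the starting point t leaves the smoothed mass at the meeting
    place. *)
Lemma integral_coupling xi f z w u : invariant_random_measure theta xi ->
  measurable_fun setT f -> (forall w, 0 <= f w) ->
  measurable_fun setT z -> (forall w, 0 <= z w) ->
  \int[xi w]_t (f (theta t w) * coupling z w t u) =
  average (fun w => z w * smooth xi f w) (theta u w).
Proof.
move=> xi_inv mf f0 mz z0.
pose F (x : borel G * borel G) := f (theta x.1 w) *
  (p (x.2 - x.1)%R * (p (x.2 - u)%R * z (theta x.2 w))).
have mF : measurable_fun setT F by measurability.
have F0 x : 0 <= F x by rewrite !mule_ge0.
transitivity (\int[xi w]_t \int[lambda]_s F (t, s)).
  apply: eq_integral => t _; rewrite -ge0_integralZl//.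
  - by measurability.
  - by move=> s _; rewrite !mule_ge0.
transitivity (\int[lambda]_s \int[xi w]_t F (t, s)).
  apply: sigma_finite_tonelli => //; first exact: lfmeasure_sigma_finite.
  exact: haar_sigma_finite.
rewrite average_flow.
- apply: eq_integral => s _; rewrite /F /=.
  rewrite smooth_flow// muleA.
  rewrite -ge0_integralZl//.
  + apply: eq_integral => t _.
    by rewrite muleA [RHS]muleC [f _ * _]muleC.
  + by measurability.
  + by move=> t _; rewrite mule_ge0.
  + by rewrite mule_ge0.
- by apply: emeasurable_funM => //; exact: measurable_smooth.
- by move=> w'; rewrite mule_ge0// smooth_ge0.
Qed.

Definition meeting_rate n xi eta w : \bar R :=
  rate (smooth xi (residue n xi eta) w) (smooth eta (residue n eta xi) w).

Lemma meeting_rateC n xi eta : meeting_rate n xi eta = meeting_rate n eta xi.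
Proof. by apply/funext => w; rewrite /meeting_rate rateC. Qed.

Lemma measurable_meeting_rate n xi eta : measurable_fun setT (meeting_rate n xi eta).
Proof.
apply: measurable_rate; [exact: measurable_smooth|exact: measurable_smooth|].
by move=> w; exact: smooth_ge0.
Qed.

Lemma meeting_rate_ge0 n xi eta w : 0 <= meeting_rate n xi eta w.
Proof. by apply: rate_ge0; exact: smooth_ge0. Qed.

(** What both points still hold in round n, times the rate at which they meet:
    the mass that t sends in this round to a unit of eta at u. *)
Definition transport_term n xi eta w t u : \bar R := residue n xi eta (theta t w) *
  (residue n eta xi (theta u w) * coupling (meeting_rate n xi eta) w t u).

Definition transport_density xi eta w t u : \bar R :=
  \sum_(n <oo) transport_term n xi eta w t u.

Let transport_term_ge0 n xi eta w t u : 0 <= transport_term n xi eta w t u.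
Proof.
by rewrite !mule_ge0// coupling_ge0// => w'; exact: meeting_rate_ge0.
Qed.

Let measurable_transport_term n xi eta : measurable_fun setT
  (fun x : Omega * borel G * borel G => transport_term n xi eta x.1.1 x.1.2 x.2).
Proof.
have mf := measurable_residue n xi eta.
have mg := measurable_residue n eta xi.
have mc : measurable_fun setT (fun x : Omega * borel G * borel G =>
    coupling (meeting_rate n xi eta) x.1.1 x.1.2 x.2).
  apply: measurable_coupling => [|w]; first exact: measurable_meeting_rate.
  exact: meeting_rate_ge0.
apply: emeasurable_funM; first by measurability.
by apply: emeasurable_funM => //; measurability.
Qed.

Lemma transport_density_ge0 xi eta w t u : 0 <= transport_density xi eta w t u.
Proof. by apply: nneseries_ge0 => n _ _; exact: transport_term_ge0. Qed.

Lemma measurable_transport_density xi eta : measurable_fun setT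
  (fun x : Omega * borel G * borel G => transport_density xi eta x.1.1 x.1.2 x.2).
Proof.
apply: (ge0_emeasurable_sum (h := fun n (x : Omega * borel G * borel G) =>
  transport_term n xi eta x.1.1 x.1.2 x.2)) => [n x _ _|n _].
  exact: transport_term_ge0.
exact: measurable_transport_term.
Qed.

Lemma transport_densityC xi eta w t u :
  transport_density xi eta w t u = transport_density eta xi w u t.
Proof.
apply: eq_eseriesr => n _.
by rewrite /transport_term muleCA couplingC meeting_rateC.
Qed.

Lemma transport_density_flow xi eta w t u v :
  transport_density xi eta (theta v w) (t - v)%R (u - v)%R =
  transport_density xi eta w t u.
Proof.
apply: eq_eseriesr => n _; rewrite /transport_term.
rewrite !(flowD theta_flow) !subrK coupling_flow//.
  exact: measurable_meeting_rate.
exact: meeting_rate_ge0.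
Qed.

Lemma integral_transport_density_source xi eta w u :
  invariant_random_measure theta xi ->
  \int[xi w]_t transport_density xi eta w t u =
  \sum_(n <oo) matched n eta xi (theta u w).
Proof.
move=> xi_inv.
have mt n : measurable_fun setT (fun t : borel G => transport_term n xi eta w t u).
  exact: (measurableT_comp (measurable_transport_term n xi eta)
    (measurable_fun_pair (measurable_fun_pair (measurable_cst w)
      (@measurable_id _ _ setT)) (measurable_cst u))).
rewrite (integral_nneseries _ measurableT mt)//.
apply: eq_eseriesr => n _; rewrite /transport_term.
have mz := measurable_meeting_rate n xi eta.
have z0 := meeting_rate_ge0 n xi eta.
have accE : (fun w => meeting_rate n xi eta w * smooth xi (residue n xi eta) w) =
    acceptance eta xi (residue n eta xi) (residue n xi eta).
  by apply/funext => w'; rewrite /acceptance /meeting_rate rateC.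
under eq_integral do rewrite muleCA.
rewrite ge0_integralZl//.
- rewrite /matched -accE; congr (_ * _); exact: integral_coupling.
- have mf := measurable_residue n xi eta.
  apply: emeasurable_funM; first by measurability.
  exact: (measurableT_comp (measurable_coupling mz z0)
    (measurable_fun_pair (measurable_fun_pair (measurable_cst w)
      (@measurable_id _ _ setT)) (measurable_cst u))).
- by move=> t _; rewrite mule_ge0// coupling_ge0.
Qed.

Lemma integral_transport_density_target xi eta w t :
  invariant_random_measure theta eta ->
  \int[eta w]_u transport_density xi eta w t u =
  \sum_(n <oo) matched n xi eta (theta t w).
Proof.
move=> eta_inv; rewrite -(integral_transport_density_source xi w t eta_inv).
by apply: eq_integral => u _; rewrite transport_densityC.
Qed.

(** Campbell's formula for the weight r |-> p (- r), of integral 1, and the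
    window B. *)
Lemma integral_smooth (zeta : random_measure Omega R G) B J :
  invariant_random_measure theta zeta ->
  measurable B -> invariant_sigma_field theta J ->
  lambda B * \int[P]_w ((\1_J w)%:E * smooth zeta (cst 1) w) =
  \int[P]_w ((\1_J w)%:E * zeta w B).
Proof.
move=> zeta_inv mB hJ; have [mJ _] := hJ.
have jE := invariant_indic hJ.
have mj := @measurable_eindic _ _ R _ mJ.
have mb := @measurable_eindic _ _ R _ mB.
have mpN : measurable_fun setT (fun s : borel G => p (- s)%R) by measurability.
have h : lambda B * \int[P]_o \int[zeta o]_r (p (- r)%R * (\1_J (theta r o))%:E) =
    \int[P]_o \int[zeta o]_r ((\1_B r)%:E * (\1_J (theta r o))%:E).
  transitivity ((\int[lambda]_s p (- s)%R) *
      \int[P]_o \int[zeta o]_r ((\1_B r)%:E * (\1_J (theta r o))%:E)); last first.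
    rewrite (haar_opp G_locally_compact G_second_countable lambda_haar)//.
    by rewrite p_integral mul1e.
  have -> : lambda B = \int[lambda]_s (\1_B s)%:E by rewrite integral_indic// setIT.
  by apply: (campbell (phi := fun w => (\1_J w)%:E)) => // w; rewrite lee_fin.
transitivity (lambda B * \int[P]_o \int[zeta o]_r (p (- r)%R * (\1_J (theta r o))%:E)).
  congr (_ * _); apply: eq_integral => w _; rewrite /smooth -ge0_integralZl//.
  - by apply: eq_integral => r _; rewrite mule1 jE muleC.
  - by apply: emeasurable_funM => //; exact: measurable_cst.
  - by move=> r _; rewrite mule1.
rewrite h; apply: eq_integral => w _.
under eq_integral do rewrite jE muleC.
rewrite ge0_integralZl ?lee_fin//.
by rewrite integral_indic// setIT.
Qed.

Section two_random_measures.
Context (xi eta : random_measure Omega R G).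
Context (xi_invariant : invariant_random_measure theta xi).
Context (eta_invariant : invariant_random_measure theta eta).

(** From a density D with marginal deficits U and V to a balancing kernel.  The
    deficit U at the source is made up for by leaving the mass where it is; this
    yields a Markov kernel for every w, and balances as soon as the deficits are
    not charged. *)
Section construction.
Context (D : Omega * borel G * borel G -> \bar R).
Context (mD : measurable_fun setT D) (D0 : forall x, 0 <= D x).
Context (U V : Omega -> \bar R).
Context (mU : measurable_fun setT U) (U0 : forall w, 0 <= U w).
Context (D_flow : forall w s u t,
  D (theta t w, (s - t)%R, (u - t)%R) = D (w, s, u)).
Context (target : forall w s, \int[eta w]_u D (w, s, u) + U (theta s w) = 1).
Context (source : forall w u, \int[xi w]_s D (w, s, u) + V (theta u w) = 1).
Context (U_null : {ae P, forall w, {ae xi w, forall s, U (theta s w) = 0}}).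
Context (V_null : {ae P, forall w, {ae eta w, forall u, V (theta u w) = 0}}).

Lemma balancing_kernel_of_density :
  exists T : R.-pker (Omega * borel G) ~> borel G,
    invariant_kernel theta T /\ ae_balancing P xi eta T.
Proof.
have mUt : measurable_fun setT (fun x : Omega * borel G => U (theta x.2 x.1)).
  exact: (measurableT_comp (mU)
    (measurable_flowf theta_flow measurable_fst measurable_snd)).
have total (x : Omega * borel G) :
    \int[eta x.1]_u D (x, u) + U (theta x.2 x.1) = 1.
  by case: x => w s; exact: target.
have [T TE] := exists_density_kernel G_locally_compact G_second_countable
  (m := fun x : Omega * borel G => eta x.1)
  (measurableT_comp (measurable_lf eta) measurable_fst)
  (mD) (D0) mUt (fun x => U0 _) measurable_snd total.
have mDx w s : measurable_fun setT (fun u : borel G => D (w, s, u)).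
  by measurability.
exists T; split.
- move=> s t w B mB; rewrite !TE /=.
  congr (_ + _); last first.
    rewrite (flowD theta_flow) subrK; congr (_ * _).
    rewrite !diracE shiftE; congr (_%:R%:E); congr (nat_of_bool _).
    by apply/idP/idP; rewrite !inE /= subrK.
  have mS := measurable_shift G_second_countable t mB.
  rewrite integral_mkcond [RHS]integral_mkcond.
  have mR (f : borel G -> \bar R) A : measurable A -> measurable_fun setT f ->
      measurable_fun setT (f \_ A).
    move=> mA mf; apply/(measurable_restrictT f mA).
    exact: measurable_funTS.
  rewrite (integral_invariant_shift _ _ eta_invariant).
  + apply: eq_integral => u _; rewrite /patch shiftE.
    have -> : (u - t \in (fun x : borel G => x + t : borel G)%R @^-1` B)%R = (u \in B).
      by apply/idP/idP; rewrite !inE /= subrK.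
    by case: ifP => // _; exact: D_flow.
  + exact: mR.
  + by move=> u; apply: erestrict_ge0.
- apply: filterS2 U_null V_null => w xw ew B mB.
  have mDw : measurable_fun setT
      (fun z : borel G * borel G => D (w, z.1, z.2)).
    by measurability.
  have mDB : measurable_fun setT (fun z : borel G * borel G =>
      D (w, z.1, z.2) * (\1_B z.2)%:E).
    apply: emeasurable_funM => //; apply/measurable_EFinP.
    exact: (measurableT_comp (measurable_indic mB)).
  have DB0 z : 0 <= D (w, z.1, z.2) * (\1_B z.2)%:E.
    by rewrite mule_ge0// lee_fin.
  transitivity (\int[xi w]_s \int[eta w]_u (D (w, s, u) * (\1_B u)%:E)).
    apply: ge0_ae_eq_integral => //.
    + have := measurable_kernel T B mB => mT.
      exact: (measurableT_comp mT (measurable_fun_pair (measurable_cst w)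
        (@measurable_id _ _ setT))).
    + apply: (measurable_integral_lfmeasure G_locally_compact G_second_countable
        (m := fun=> eta w)
        (f := fun z => D (w, z.1, z.2) * (\1_B z.2)%:E)) => //.
    + by move=> s _; apply: integral_ge0 => u _; exact: (DB0 (s, u)).
    + move: xw; apply: filterS => s us _; rewrite TE /= us mul0e adde0.
      rewrite integral_mkcond.
      by apply: eq_integral => u _; rewrite epatch_indic.
  transitivity (\int[eta w]_u \int[xi w]_s (D (w, s, u) * (\1_B u)%:E)).
    apply: (sigma_finite_tonelli (m1 := xi w) (m2 := eta w)
      (f := fun z => D (w, z.1, z.2) * (\1_B z.2)%:E)) => //.
      exact: lfmeasure_sigma_finite.
    exact: lfmeasure_sigma_finite.
  transitivity (\int[eta w]_u (\1_B u)%:E); last by rewrite integral_indic// setIT.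
  apply: ge0_ae_eq_integral => //.
  + apply: (measurable_integral_lfmeasure G_locally_compact G_second_countable
      (m := fun=> xi w)
      (f := fun z => D (w, z.2, z.1) * (\1_B z.1)%:E)) => //.
    * have mswap := measurable_fun_pair (@measurable_snd _ _ (borel G) (borel G))
        (@measurable_fst _ _ (borel G) (borel G)).
      exact: (measurableT_comp mDB mswap).
    * by move=> z; exact: (DB0 (z.2, z.1)).
  + exact: measurable_eindic.
  + by move=> u _; apply: integral_ge0 => s _; exact: (DB0 (s, u)).
  + move: ew; apply: filterS => u us _; rewrite ge0_integralZr//.
    * rewrite [X in X * _](_ : _ = 1) ?mul1e//.
      by rewrite -[LHS]adde0 -us; exact: source.
    * by measurability.
Qed.

End construction.

Lemma exists_invariant_balancing_kernel :
  (forall J, invariant_sigma_field theta J ->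
    \int[P]_w ((\1_J w)%:E * smooth xi (cst 1) w) =
    \int[P]_w ((\1_J w)%:E * smooth eta (cst 1) w)) ->
  \int[P]_w smooth xi (cst 1) w < +oo ->
  \int[P]_w smooth eta (cst 1) w < +oo ->
  exists T : R.-pker (Omega * borel G) ~> borel G,
    invariant_kernel theta T /\ ae_balancing P xi eta T.
Proof.
move=> balance xi_fin eta_fin.
have U_null z z' : invariant_random_measure theta z ->
    {ae P, forall w, smooth z (unmatched z z') w = 0} ->
    {ae P, forall w, {ae z w, forall s, unmatched z z' (theta s w) = 0}}.
  move=> z_inv; apply: filterS => w; apply: smooth_eq0_ae.
    exact: measurable_unmatched.
  exact: unmatched_ge0.
apply: (@balancing_kernel_of_density
  (fun x => transport_density xi eta x.1.1 x.1.2 x.2)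
  _ _ (unmatched xi eta) (unmatched eta xi)).
- exact: measurable_transport_density.
- by move=> x; exact: transport_density_ge0.
- exact: measurable_unmatched.
- by move=> w; exact: unmatched_ge0.
- by move=> w s u t; exact: transport_density_flow.
- by move=> w s; rewrite integral_transport_density_target// unmatchedE.
- by move=> w u; rewrite integral_transport_density_source// unmatchedE.
- by apply: U_null => //; exact: unmatched_negligible.
- apply: U_null => //; apply: unmatched_negligible => // J hJ.
  exact: esym (balance J hJ).
Qed.

End two_random_measures.

End stationary_transport.

(** * Conditional expectations and the theorem *)
Section conditional_expectation.
Context (R : realType) (G : topologicalZmodType).
Context (d : measure_display) (Omega : measurableType d).
Context (theta : borel G -> Omega -> Omega).
Context (theta_flow : measurable_flow theta).
Context (P : {measure set Omega -> \bar R}).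

Local Notation condexp := (is_condexp P (invariant_sigma_field theta)).

Lemma condexp_measurable_fun X Y : condexp X Y -> measurable_fun setT Y.
Proof. by move=> [_ mY _] _ V mV; rewrite setTI; have [] := mY V mV. Qed.

(** The preimage of the singleton {Y w} is an invariant event. *)
Lemma condexp_flow X Y s w : condexp X Y -> Y (theta s w) = Y w.
Proof.
move=> [_ mY _]; have [_ inv] := mY _ (emeasurable_set1 (Y w)).
have : (theta s @` (Y @^-1` [set Y w])) (theta s w) by exists w.
by rewrite inv.
Qed.

(** Integrability of X replaces sigma-finiteness of P on the invariant events:
    the invariant event {Y' < Y} carries equal finite integrals of Y and Y'. *)
Lemma condexp_ae_le X Y Y' : condexp X Y -> condexp X Y' ->
  \int[P]_w X w < +oo -> {ae P, forall w, Y w <= Y' w}.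
Proof.
move=> cY cY' Xfin.
have mY := condexp_measurable_fun cY; have mY' := condexp_measurable_fun cY'.
have Y0 := condexp_ge0 cY; have Y'0 := condexp_ge0 cY'.
pose A := [set w | Y' w < Y w].
have mA : measurable A by rewrite -[A]setTI; exact: emeasurable_fun_lt.
have hA : invariant_sigma_field theta A.
  apply: invariant_sigma_fieldP => // s w.
  by rewrite /A /= (condexp_flow _ _ cY) (condexp_flow _ _ cY').
have hT : invariant_sigma_field theta setT by exact: invariant_sigma_fieldP.
have m1 := @measurable_eindic _ _ R _ mA.
have Yfin Z : condexp X Z -> P.-integrable setT (fun w => (\1_A w)%:E * Z w).
  move=> cZ; have Z0 := condexp_ge0 cZ; have mZ := condexp_measurable_fun cZ.
  have mAZ : measurable_fun setT (fun w => (\1_A w)%:E * Z w).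
    exact: emeasurable_funM.
  apply/integrableP; split => //; apply: le_lt_trans Xfin.
  have <- : \int[P]_w Z w = \int[P]_w X w.
    have := condexp_integral cZ hT.
    by under eq_integral do rewrite indicT mul1e;
       under [in RHS]eq_integral do rewrite indicT mul1e.
  apply: ge0_le_integral => //.
  - exact: measurableT_comp.
  - move=> w _; rewrite gee0_abs; last by rewrite mule_ge0// lee_fin.
    by rewrite indicE; case: (_ \in _); rewrite ?mul1e ?mul0e.
have mD : measurable_fun setT (fun w => (\1_A w)%:E * Y w - (\1_A w)%:E * Y' w).
  by apply: emeasurable_funB; exact: emeasurable_funM.
have D0 w : 0 <= (\1_A w)%:E * Y w - (\1_A w)%:E * Y' w.
  rewrite indicE; have [wA|_] := boolP (w \in A); last by rewrite !mul0e sube0.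
  rewrite !mul1e ltW// sube_gt0.
  by move: wA; rewrite inE.
have : \int[P]_w ((\1_A w)%:E * Y w - (\1_A w)%:E * Y' w) = 0.
  rewrite integralB//; [|exact: Yfin|exact: Yfin].
  rewrite (condexp_integral cY hA) -(condexp_integral cY' hA) subee//.
  by apply: integrable_fin_num => //; exact: Yfin.
move=> /(ge0_integral_eq0_ae mD D0); apply: filterS => w.
rewrite indicE; have [|wA _] := boolP (w \in A).
  rewrite inE /A /= !mul1e => YY Y0w; move: YY.
  by rewrite -sube_gt0 Y0w ltxx.
by rewrite leNgt; apply: contraNN wA; rewrite inE.
Qed.

Lemma condexp_unique X Y Y' : condexp X Y -> condexp X Y' ->
  \int[P]_w X w < +oo -> {ae P, forall w, Y w = Y' w}.
Proof.
move=> cY cY' Xfin.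
have le1 := condexp_ae_le cY cY' Xfin; have le2 := condexp_ae_le cY' cY Xfin.
by apply: filterS2 le1 le2 => w YY' Y'Y; apply/eqP; rewrite eq_le YY'.
Qed.

End conditional_expectation.

Lemma exists_haar_window (R : realType) (G : topologicalZmodType)
    (lambda : {measure set (borel G) -> \bar R}) :
  locally_compact [set: G] -> @second_countable G -> haar_measure lambda ->
  exists B : set (borel G), measurable B /\ 0 < lambda B < +oo.
Proof.
move=> lc sc [lf l0 _].
have [D [mD ndD UD fD]] := borel_exhaustion R lc sc.
have [h|h] := pselect (forall n, lambda (D n) = 0); last first.
  have [n /eqP Dn0] : exists n, lambda (D n) <> 0.
    by apply: contra_notP h => h n; apply: contra_notP h => h; exists n.
  by exists (D n); split => //; rewrite lt0e Dn0 measure_ge0/=; exact: fD.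
suff : lambda setT = 0 by move=> /eqP; rewrite (negbTE l0).
have D_cvg : lambda \o D @ \oo --> lambda (\bigcup_n D n).
  by apply: nondecreasing_cvg_mu => //; exact: bigcup_measurable.
rewrite -UD -(cvg_lim _ D_cvg)//.
rewrite (_ : lambda \o D = cst 0); first by rewrite lim_cst.
by apply/funext => n /=; exact: h.
Qed.

Lemma palm_setT (R : realType) (G : topologicalZmodType)
    (lambda : {measure set (borel G) -> \bar R}) (d : measure_display)
    (Omega : measurableType d) (theta : borel G -> Omega -> Omega)
    (P : {measure set Omega -> \bar R}) (xi : random_measure Omega R G) B :
  measurable B -> palm lambda theta P xi B setT =
  (fine (lambda B))^-1%:E * \int[P]_w xi w B.
Proof.
move=> mB; rewrite /palm; congr (_ * _); apply: eq_integral => w _.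
under eq_integral do rewrite indicT mul1e.
by rewrite integral_indic// setIT.
Qed.

Lemma finite_intensity (R : realType) (G : topologicalZmodType)
    (lambda : {measure set (borel G) -> \bar R}) (d : measure_display)
    (Omega : measurableType d) (theta : borel G -> Omega -> Omega)
    (P : {measure set Omega -> \bar R}) (xi : random_measure Omega R G) B :
  positive_finite_intensity lambda theta P xi ->
  measurable B -> 0 < lambda B < +oo -> \int[P]_w xi w B < +oo.
Proof.
move=> hxi mB lB; have /andP[_] := hxi B mB lB.
rewrite palm_setT//; case: (\int[P]_w xi w B) => [r||]//; rewrite ?ltry//.
rewrite gt0_muley// lte_fin invr_gt0 fine_gt0//.
Qed.

Theorem theorem5p1 (R : realType) (G : topologicalZmodType)
  (G_locally_compact : locally_compact [set: G])
  (G_second_countable : @second_countable G)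
  (G_hausdorff : hausdorff_space G)
  (lambda : {measure set (borel G) -> \bar R})
  (lambda_haar : haar_measure lambda)
  (d : measure_display) (Omega : measurableType d)
  (theta : borel G -> Omega -> Omega)
  (theta_flow : measurable_flow theta)
  (P : {measure set Omega -> \bar R})
  (P_sigma_finite : sigma_finite [set: Omega] P)
  (P_stationary : stationary theta P)
  (xi eta : random_measure Omega R G)
  (xi_invariant : invariant_random_measure theta xi)
  (eta_invariant : invariant_random_measure theta eta)
  (xi_intensity : positive_finite_intensity lambda theta P xi)
  (eta_intensity : positive_finite_intensity lambda theta P eta)
  (condexp_defined : forall B : set (borel G), measurable B ->
     0 < lambda B < +oo ->
     has_condexp P (invariant_sigma_field theta) (fun w => xi w B) /\
     has_condexp P (invariant_sigma_field theta) (fun w => eta w B)) :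
  (exists T : R.-pker (Omega * borel G) ~> borel G,
     invariant_kernel theta T /\ ae_balancing P xi eta T)
  <->
  (exists B : set (borel G), [/\ measurable B, 0 < lambda B < +oo &
     ae_eq_condexp P (invariant_sigma_field theta)
       (fun w => xi w B) (fun w => eta w B)]).
Proof.
have lc := G_locally_compact; have sc := G_second_countable.
split.
- move=> [T [T_inv T_bal]].
  have [B [mB lB]] := exists_haar_window lc sc lambda_haar.
  exists B; split => //.
  have [[Y cY] [Y' cY']] := condexp_defined B mB lB.
  exists Y, Y'; split => //.
  apply: (condexp_unique theta_flow cY) _ (finite_intensity xi_intensity mB lB).
  case: cY' => Y'0 mY' Y'I; split => // J hJ; rewrite Y'I//.
  apply/esym; exact: (balancing_invariant_integral lc sc lambda_haar theta_flow
    P_sigma_finite P_stationary xi_invariant T_inv T_bal).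
- move=> [B [mB lB [Y [Y' [cY cY' YY']]]]].
  have [p [mp p0 pI]] := haar_density lc sc lambda_haar.
  have p_ge0 s : 0 <= p s by exact: ltW.
  have /andP[lB0 lBoo] := lB.
  have lB_inv x : (fine (lambda B))^-1%:E * (lambda B * x) = x.
    have lB_fin : lambda B \is a fin_num by rewrite ge0_fin_numE// ltW.
    rewrite muleA -[X in _ * X * _]fineK// -EFinM mulVf ?mul1e// gt_eqF//.
    by rewrite fine_gt0 ?lB0.
  have smoothE (zeta : random_measure Omega R G) J :
      invariant_random_measure theta zeta -> invariant_sigma_field theta J ->
      \int[P]_w ((\1_J w)%:E * smooth theta p zeta (cst 1) w) =
      (fine (lambda B))^-1%:E * \int[P]_w ((\1_J w)%:E * zeta w B).
    move=> zeta_inv hJ; rewrite -[LHS]lB_inv; congr (_ * _).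
    exact: (integral_smooth lc sc lambda_haar theta_flow P_sigma_finite
      P_stationary).
  have fin (zeta : random_measure Omega R G) :
      invariant_random_measure theta zeta ->
      positive_finite_intensity lambda theta P zeta ->
      \int[P]_w smooth theta p zeta (cst 1) w < +oo.
    move=> zeta_inv hzeta.
    have hT : invariant_sigma_field theta setT by exact: invariant_sigma_fieldP.
    have := smoothE zeta setT zeta_inv hT.
    under eq_integral do rewrite indicT mul1e.
    under [in RHS]eq_integral do rewrite indicT mul1e.
    move=> ->; have /andP[_] := hzeta B mB lB.
    by rewrite palm_setT.
  apply: (exists_invariant_balancing_kernel lc sc lambda_haar theta_flow
    P_sigma_finite P_stationary mp p0 pI xi_invariant eta_invariant).
  + move=> J hJ; rewrite !smoothE//; congr (_ * _).
    rewrite -(condexp_integral cY hJ) -(condexp_integral cY' hJ).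
    have [mJ _] := hJ.
    have m1 := @measurable_eindic _ _ R _ mJ.
    have j0 w : 0 <= (\1_J w)%:E :> \bar R by rewrite lee_fin.
    apply: ge0_ae_eq_integral => //.
    * by apply: emeasurable_funM => //; exact: (condexp_measurable_fun cY).
    * by apply: emeasurable_funM => //; exact: (condexp_measurable_fun cY').
    * by move=> w _; rewrite mule_ge0//; exact: (condexp_ge0 cY).
    * by move=> w _; rewrite mule_ge0//; exact: (condexp_ge0 cY').
    * by move: YY'; apply: filterS => w -> _.
  + exact: fin.
  + exact: fin.
Qed.
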